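(* Let $\phi_{-,\nu}(x)=xI_{\nu-1}(x)/I_\nu(x)$ and $\phi_{+,\nu}(x)=xK_{\nu+1}(x)/K_\nu(x)$. Then both functions satisfy the following properties for $\nu\ge1/2$ and $x>0$: $$0<\phi_{\pm,\nu}'(x)\le1,$$ $$\nu+\sqrt{\nu^2+x(x-1)}<\phi_{\pm,\nu}(x)\le\nu+\sqrt{\nu^2+x(x+1)},$$ where the equalities only take place for $\phi_{+,\nu}(x)$ when $\nu=1/2$. The upper bound for $\phi_{+,\nu}(x)$ and the lower bound for $\phi_{-,\nu}(x)$ are of accuracy $(1,3)$.
   Context: $I_\nu$, $K_\nu$ denote the modified Bessel functions of the first and second kind of real order $\nu$. Accuracy $(n,m)$ of a bound refers to the corresponding bound (obtained by dividing by $x$) for the ratio $I_{\nu-1}(x)/I_\nu(x)$ or $K_{\nu+1}(x)/K_\nu(x)$: it means that the first $n$ terms of the expansion of the bound as $x\to0^+$ coincide with those of the ratio, and that the first $m$ terms of the expansion as $x\to+\infty$ (in powers $x^0,x^{-1},x^{-2},\dots$) coincide with those of the ratio. The leading term of both ratios as $x\to0^+$ is $2\nu/x$; as $x\to+\infty$, the first three terms of $I_{\nu-1}(x)/I_\nu(x)$ are $1+\frac{\nu-1/2}{x}+\frac{\nu^2-1/4}{2x^2}$ and those of $K_{\nu+1}(x)/K_\nu(x)$ are $1+\frac{\nu+1/2}{x}+\frac{\nu^2-1/4}{2x^2}$. *)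

(* Defs.v *)
From HB Require Import structures.
From mathcomp Require Import all_boot all_order all_algebra.
From mathcomp Require Import all_classical all_reals all_analysis.
Set Implicit Arguments.
Unset Strict Implicit.
Unset Printing Implicit Defensive.
Import Order.TTheory GRing.Theory Num.Theory.
Import numFieldNormedType.Exports.
Local Open Scope classical_set_scope.
Local Open Scope ring_scope.

Definition cosh (R : realType) (t : R) : R := (expR t + expR (- t)) / 2.

(* Euler's integral; meaningful for 0 < s only. *)
Definition Gamma (R : realType) (s : R) : R :=
  Rintegral (@lebesgue_measure R) `]0, +oo[
    (fun t => t `^ (s - 1) * expR (- t)).

(* The entire function 1 / Gamma, on the whole real line:
   1 / Gamma(s) = s (s + 1) ... (s + n - 1) / Gamma(s + n) for any n such that
   0 < s + n; here n = Num.bound s > `|s|.  It vanishes at 0, -1, -2, ... *)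
Definition invGamma (R : realType) (s : R) : R :=
  (\prod_(i < Num.bound s) (s + i%:R)) / Gamma (s + (Num.bound s)%:R).

(* I_nu(x) = \sum_k (x / 2)^(2 k + nu) / (k! Gamma(k + nu + 1)), for 0 < x. *)
Definition besselI (R : realType) (nu x : R) : R :=
  lim (series (fun k : nat =>
    (x / 2) `^ (k.*2%:R + nu) * invGamma (k%:R + nu + 1) / k`!%:R) @ \oo).

(* K_nu(x), for 0 < x and every real nu, by its classical integral. *)
Definition besselK (R : realType) (nu x : R) : R :=
  Rintegral (@lebesgue_measure R) `[0, +oo[
    (fun t => expR (- (x * cosh t)) * cosh (nu * t)).

Definition ratioI (R : realType) (nu x : R) : R :=
  besselI (nu - 1) x / besselI nu x.

Definition ratioK (R : realType) (nu x : R) : R :=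
  besselK (nu + 1) x / besselK nu x.

Definition phi_minus (R : realType) (nu x : R) : R := x * ratioI nu x.

Definition phi_plus (R : realType) (nu x : R) : R := x * ratioK nu x.

Definition lower_bound (R : realType) (nu x : R) : R :=
  nu + Num.sqrt (nu ^+ 2 + x * (x - 1)).

Definition upper_bound (R : realType) (nu x : R) : R :=
  nu + Num.sqrt (nu ^+ 2 + x * (x + 1)).

(* A term c x^p (ln x)^q of an expansion as x -> 0+.  Powers of ln x are needed
   because they occur, beyond the leading term, in the expansion of ratioK nu
   for integer nu. *)
Definition term0 (R : realType) (c p : R) (q : nat) (x : R) : R :=
  c * x `^ p * ln x ^+ q.

(* The first n terms of the expansion of f as x -> 0+ are
   term0 (c k) (p k) (q k), k < n: they are nonzero and, for each k < n, the
   remainder after the k-th term is negligible with respect to that term. *)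
Definition first_terms_0 (R : realType) (n : nat) (c p : nat -> R)
    (q : nat -> nat) (f : R -> R) : Prop :=
  forall k : nat, (k < n)%N ->
    c k != 0 /\
    (f x - \sum_(j < k.+1) term0 (c j) (p j) (q j) x)
      / term0 (c k) (p k) (q k) x @[x --> 0^'+] --> (0 : R).

(* The first m terms of the expansion of f as x -> +oo, in the powers
   x^0, x^-1, x^-2, ..., are a k x^-k, k < m; the a k may vanish. *)
Definition first_terms_oo (R : realType) (m : nat) (a : nat -> R)
    (f : R -> R) : Prop :=
  forall k : nat, (k < m)%N ->
    (f x - \sum_(j < k.+1) a j * x ^- j) * x ^+ k @[x --> +oo] --> (0 : R).

(* [accuracy n m r b]: the bound b of the ratio r has accuracy (n, m). *)
Definition accuracy (R : realType) (n m : nat) (r b : R -> R) : Prop :=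
  (exists c p q, first_terms_0 n c p q r /\ first_terms_0 n c p q b) /\
  (exists a, first_terms_oo m a r /\ first_terms_oo m a b).

(* Main.v *)
Require Import Defs.
From HB Require Import structures.
From mathcomp Require Import all_boot all_order all_algebra.
From mathcomp Require Import ring lra.
From mathcomp Require Import all_classical all_reals all_analysis.
From mathcomp Require Import measurable_realfun.
Import Order.TTheory GRing.Theory Num.Theory.
Import numFieldNormedType.Exports.
Local Open Scope classical_set_scope.
Local Open Scope ring_scope.

(** Write [phi] for [phi_minus nu] or [phi_plus nu]. The differentiation formulas
    and the recurrence of the Bessel functions give the Riccati equations
<<
      x phi' = x^2 + nu^2 - (phi - nu)^2     for phi_minus,
      x phi' = (phi - nu)^2 - x^2 - nu^2     for phi_plus.
>>
    Solved for [phi], they say that [phi = nu + sqrt (nu^2 + x * (x + s))] with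
    [s = - phi'] for [phi_minus] and [s = phi'] for [phi_plus]. The lower bound
    is the value of this expression at [s = -1] and the upper bound its value at
    [s = 1]; as it increases with [s], all the inequalities and their cases of
    equality reduce to [0 < phi' < 1] for [phi_minus], and to [0 < phi' <= 1],
    with [phi' = 1] only for [nu = 1 / 2], for [phi_plus].

    These bounds on the slope are properties of the differential equations
    together with a little information at one end of the half line. Along the
    equation for [phi_minus] perturbations decay, and it suffices to know
    [2 nu <= phi <= 2 nu + O(x^2)] at [0] ([decaying_riccati_slope]). Along the
    equation for [phi_plus] they grow exponentially, and it suffices to know
    [phi >= nu + x] and [phi = x + O(1)] at infinity
    ([growing_riccati_slope]). In both cases the auxiliary quantity is
    [d = phi - nu - x + 1 / 2], respectively [d = phi - nu - x - 1 / 2]: it has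
    derivative [phi' - 1], and once [0 <= d] is known, the differentiated
    equation prevents [phi' - 1] from becoming positive and [phi'] from becoming
    negative.

    For the first kind, positivity of the power series and the recurrence
    [phi_nu = 2 nu + x^2 / phi_(nu + 1)] give the information at [0]. The series
    only requires the functional equation of [1 / Gamma], obtained by
    integration by parts. For the second kind, the equation comes from
    differentiation under the integral sign and one integration by parts, and the
    information at infinity from [cosh t >= 1].

    The accuracy at [0] holds because the lower and the upper bound both tend to
    [2 nu]. At infinity one of the two bounds has the right three terms
    ([cvg_slope_root_oo]); a bound on the other side with the same three terms is
    obtained by inserting the bound for the order [nu + 1] in the recurrence
    ([cvg_recurrence_bound]). *)

Set Implicit Arguments.
Unset Strict Implicit.
Unset Printing Implicit Defensive.

(** * Comparison lemmas on the positive half line *)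

Lemma is_derive_sqr_pos {R : realType} (y : R) :
  is_derive y 1 (fun z : R => Num.max z 0 ^+ 2) (2 * Num.max y 0).
Proof.
have [y0|y0|->] := ltgtP y 0.
- rewrite mulr0.
  apply: (@near_eq_is_derive _ _ _ (cst (0 : R))).
  near=> z; rewrite /= max_r ?expr0n//.
  by apply: ltW; near: z; exact: lt_nbhsl.
- apply: (@near_eq_is_derive _ _ _ (fun z : R => z ^+ 2)).
    near=> z; rewrite /= max_l //.
    by apply: ltW; near: z; exact: lt_nbhsr.
  by apply: is_derive_eq; rewrite /GRing.scale /=; lra.
- (* At 0 the difference quotient is the positive part itself. *)
  apply/is_derive1_caratheodory; exists (fun z => Num.max z 0); split.
  + move=> z; rewrite maxxx expr0n subr0 /=.
    by case: (leP z 0) => _; rewrite ?mul0r ?expr0n// subr0 expr2.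
  + apply: (@continuous_max _ _ (fun z : R => z) (fun=> 0)) => //.
    exact: cst_continuous.
  + by rewrite maxxx mulr0.
Unshelve. all: by end_near. Qed.

Lemma is_derive_continuous {R : realType} (f : R -> R) (df x : R) :
  is_derive x 1 f df -> {for x, continuous f}.
Proof.
by move=> [fx _]; apply: differentiable_continuous; exact/derivable1_diffP.
Qed.

(** The square of the positive part of [f] is differentiable and its derivative
    vanishes wherever [f <= 0]; so a condition on [df] that holds only where
    [f] is positive controls this square everywhere. *)
Lemma sqr_pos_MVT {R : realType} (f df : R -> R) (x y : R) :
  (forall z : R, 0 < z -> is_derive z 1 f (df z)) -> 0 < x -> x <= y ->
  exists2 c, x <= c & Num.max (f y) 0 ^+ 2 - Num.max (f x) 0 ^+ 2 =
                      2 * Num.max (f c) 0 * df c * (y - x).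
Proof.
move=> Df x0 xy.
pose g (z : R) := Num.max (f z) 0 ^+ 2.
have Dg (z : R) : 0 < z -> is_derive z 1 g (2 * Num.max (f z) 0 * df z).
  by move=> /Df Hf; exact: (@is_derive1_comp _ (fun z : R => Num.max z 0 ^+ 2) f z
    _ _ (is_derive_sqr_pos (f z)) Hf).
have [z| |c] :=
    MVT_segment xy (f := g) (df := fun z => 2 * Num.max (f z) 0 * df z).
- by rewrite in_itv/= => /andP[xz _]; apply: Dg; exact: lt_trans xz.
- apply: derivable_within_continuous => z; rewrite in_itv/= => /andP[xz _].
  by case: (Dg z (lt_le_trans x0 xz)).
- by rewrite in_itv/= => /andP[xc _] E; exists c.
Qed.

(** Once positive, such an [f] keeps growing at a rate bounded below by a
    positive constant, which a function bounded near infinity cannot do. *)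
Lemma nonpos_of_bounded_growth {R : realType} (f df : R -> R) (M X : R) :
  (forall x : R, 0 < x -> is_derive x 1 f (df x)) ->
  (forall x : R, 0 < x -> 0 < f x -> f x <= df x) ->
  (forall x : R, X <= x -> f x <= M) ->
  forall x : R, 0 < x -> f x <= 0.
Proof.
move=> Df fdf fM x0 x00; rewrite leNgt; apply/negP => fx0.
pose g (x : R) := Num.max (f x) 0 ^+ 2.
have g_le (x : R) : 0 < x -> 2 * g x <= 2 * Num.max (f x) 0 * df x.
  rewrite /g => xp; case: (leP (f x) 0) => fxp.
    by rewrite expr0n !mulr0 mul0r.
  by rewrite -mulrA ler_pM2l// expr2 ler_pM2l//; exact: fdf.
have g_ge0 (x : R) : 0 <= g x by rewrite /g sqr_ge0.
have g_mono (x y : R) : 0 < x -> x <= y -> g x <= g y.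
  move=> xp xy; have [c xc E] := sqr_pos_MVT Df xp xy.
  rewrite -subr_ge0 E mulr_ge0 ?subr_ge0//.
  by apply: le_trans (g_le c (lt_le_trans xp xc)); rewrite mulr_ge0.
have gx0 : 0 < g x0 by rewrite /g max_l ?exprn_gt0// ltW.
have g_lin (y : R) : x0 <= y -> g x0 + 2 * g x0 * (y - x0) <= g y.
  move=> xy; have [c xc E] := sqr_pos_MVT Df x00 xy.
  rewrite -lerBrDl E ler_wpM2r ?subr_ge0//.
  apply: le_trans (g_le c (lt_le_trans x00 xc)).
  by rewrite ler_pM2l//; exact: g_mono.
(* Far enough for the linear lower bound [g_lin] to exceed [M ^+ 2]. *)
pose y := Num.max X (x0 + (`|M| ^+ 2 / (2 * g x0))).
have xy : x0 <= y.
  by rewrite /y le_max lerDl divr_ge0 ?orbT ?exprn_ge0// mulr_ge0// ltW.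
have := g_lin y xy.
have gyM : g y <= `|M| ^+ 2.
  rewrite /g lerXn2r ?nnegrE ?le_max ?lexx ?orbT ?normr_ge0//.
  rewrite ge_max normr_ge0 andbT; apply: le_trans (ler_norm _); apply: fM.
  by rewrite /y le_max lexx.
have : `|M| ^+ 2 <= 2 * g x0 * (y - x0).
  have gx2 : 0 < 2 * g x0 by lra.
  by rewrite [leRHS]mulrC -ler_pdivrMr// lerBrDl /y le_max lexx orbT.
lra.
Qed.

(** The mirror image of the previous lemma: a positive value of [f] can only
    come from at least as large a value further to the left, hence from the
    limit at [0]. *)
Lemma nonpos_of_decay {R : realType} (f df : R -> R) (l : R) :
  (forall x : R, 0 < x -> is_derive x 1 f (df x)) ->
  (forall x : R, 0 < x -> 0 < f x -> df x <= 0) ->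
  f x @[x --> 0^'+] --> l -> l <= 0 ->
  forall x : R, 0 < x -> f x <= 0.
Proof.
move=> Df fdf fl l0 x0 x00; rewrite leNgt; apply/negP => fx0.
have dg_le (x : R) : 0 < x -> 2 * Num.max (f x) 0 * df x <= 0.
  move=> xp; case: (leP (f x) 0) => fxp; first by rewrite mulr0 mul0r.
  by rewrite mulr_ge0_le0 ?mulr_ge0 ?(ltW fxp)// fdf.
near (at_right (0 : R)) => a.
have a0 : 0 < a by near: a; exact: nbhs_right_gt.
have ax : a <= x0 by near: a; exact: nbhs_right_le.
have : f a < f x0.
  near: a; apply: (cvgr_lt l) => //; exact: le_lt_trans fx0.
have [c ac E] := sqr_pos_MVT Df a0 ax.
have : Num.max (f x0) 0 ^+ 2 <= Num.max (f a) 0 ^+ 2.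
  by rewrite -subr_le0 E mulr_le0_ge0 ?subr_ge0// dg_le// (lt_le_trans a0).
rewrite (max_l (ltW fx0)).
case: (leP (f a) 0) => fa; first by rewrite expr0n /= leNgt exprn_gt0.
rewrite ler_pXn2r ?nnegrE ?(ltW fa) ?(ltW fx0)//.
by move=> h /lt_le_trans /(_ h); rewrite ltxx.
Unshelve. all: by end_near. Qed.

Lemma derive_at_global_max {R : realType} (f : R -> R) (df c : R) : 0 < c ->
  (forall x : R, 0 < x -> derivable f x 1) ->
  (forall x : R, 0 < x -> f x <= f c) -> is_derive c 1 f df -> df = 0.
Proof.
move=> c0 Df fc [_ <-].
have cI : c \in `]0, (c + 1)[%R by rewrite in_itv/= c0 ltrDl ltr01.
have [| | |_ ->] := @derive1_at_max _ f 0 (c + 1) c _ _ cI.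
- by rewrite addr_ge0// ltW.
- by move=> t; rewrite in_itv/= => /andP[t0 _]; exact: Df.
- by move=> t; rewrite in_itv/= => /andP[t0 _]; exact: fc.
- by [].
Qed.

(** * The two Riccati equations *)

Lemma is_derive_div_id {R : realType} (f : R -> R) (df x : R) : 0 < x ->
  is_derive x 1 f df ->
  is_derive x 1 (fun z => f z / z) ((df - f x / x) / x).
Proof.
move=> x0 Hf.
have Hi : is_derive x 1 (fun z : R => z^-1) (- x ^- 2).
  have := @is_deriveV _ id x 1 1 (lt0r_neq0 x0) _.
  by rewrite /GRing.scale /= mulr1; apply.
apply: (is_derive_eq (is_deriveM Hf Hi)).
by rewrite /GRing.scale /=; field; rewrite lt0r_neq0.
Qed.

(** The solution of this equation that stays close to [x] at infinity is
    isolated: the difference of two solutions grows exponentially. Each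
    inequality below therefore follows by [nonpos_of_bounded_growth]: if it
    failed somewhere, the defect would be unbounded. *)
Section growing_riccati.
Context {R : realType}.
Variables (nu : R) (phi : R -> R) (C X : R).
Hypothesis nu_ge : 1 / 2 <= nu.
Hypothesis Dphi : forall x : R, 0 < x ->
  is_derive x 1 phi ((phi x ^+ 2 - 2 * nu * phi x - x ^+ 2) / x).
Hypothesis phi_ge : forall x : R, 0 < x -> nu + x <= phi x.
Hypothesis phi_le : forall x : R, X <= x -> phi x <= x + C.

(* For [nu = 1 / 2] the solution is [x + 1], that is [d = 0]; in general [v] is
   at the same time [derive1 d] and [derive1 phi - 1], a quadratic expression
   in [d] over [x]. *)
Let d (x : R) := phi x - nu - x - 1 / 2.
Let v (x : R) := (d x * (d x + 2 * x + 1) - (nu ^+ 2 - 1 / 4)) / x.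

Let slopeE (x : R) : 0 < x ->
  (phi x ^+ 2 - 2 * nu * phi x - x ^+ 2) / x = v x + 1.
Proof. by move=> x0; rewrite /v /d; field; exact: lt0r_neq0. Qed.

Let c_ge0 : 0 <= nu ^+ 2 - 1 / 4.
Proof. by have := nu_ge; nra. Qed.

Let Dd (x : R) : 0 < x -> is_derive x 1 d (v x).
Proof.
move=> x0; have Hphi := Dphi x0.
apply: is_derive_eq; rewrite /v /d /GRing.scale /=; field; exact: lt0r_neq0.
Qed.

Let Dv (x : R) : 0 < x ->
  is_derive x 1 v (((2 * d x + 2 * x) * v x + 2 * d x) / x).
Proof.
move=> x0; have Hd := Dd x0.
have HQ : is_derive x 1
    (fun z => d z * (d z + 2 * z + 1) - (nu ^+ 2 - 1 / 4))
    ((2 * d x + 2 * x + 1) * v x + 2 * d x).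
  by apply: is_derive_eq; rewrite /GRing.scale /=; ring.
apply: (is_derive_eq (is_derive_div_id x0 HQ)).
by rewrite /v; field; exact: lt0r_neq0.
Qed.

Let d_geN (x : R) : 0 < x -> - (1 / 2) <= d x.
Proof. by move=> /phi_ge; rewrite /d; lra. Qed.

Let d_ge0 (x : R) : 0 < x -> 0 <= d x.
Proof.
move=> x0; rewrite -oppr_le0.
apply: (@nonpos_of_bounded_growth _ (\- d) (\- v) (1 / 2) 1 _ _ _ _ x0).
- by move=> z z0; exact: is_deriveN (Dd z0).
- move=> z z0 /= dz; rewrite /v -mulNr ler_pdivlMr//.
  by have := d_geN z0; have := c_ge0; nra.
- by move=> z z1 /=; rewrite lerNl; apply: d_geN; lra.
Qed.

Let B := `|C - nu - 1 / 2|.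

Let d_le (x : R) : X <= x -> d x <= B.
Proof.
by move=> /phi_le h; apply: le_trans (ler_norm _); rewrite /d; lra.
Qed.

Let v_le0 (x : R) : 0 < x -> v x <= 0.
Proof.
move=> x0.
apply: (@nonpos_of_bounded_growth _ v _ (B * (B + 3)) (Num.max X 1) _ _ _ _ x0).
- by move=> z z0; exact: Dv.
- by move=> z z0 vz; rewrite ler_pdivlMr//; have := d_ge0 z0; nra.
- move=> z; rewrite ge_max => /andP[Xz z1].
  have z0 : 0 < z by lra.
  rewrite /v ler_pdivrMr//.
  have := d_le Xz; have := d_ge0 z0; have := c_ge0 => h1 h2 h3.
  have : d z * (d z + 2 * z + 1) <= B * (B + 2 * z + 1) by apply: ler_pM; lra.
  suff : B * (B + 2 * z + 1) <= B * (B + 3) * z by lra.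
  have B0 : 0 <= B by exact: normr_ge0.
  by rewrite -mulrA ler_wpM2l//; nra.
Qed.

(* By [Dv] the slope of [v] is -2 where [v = -1] and smaller below, so [v] would
   have to tend to minus infinity. *)
Let u_ge0 (x : R) : 0 < x -> 0 <= v x + 1.
Proof.
move=> x0; rewrite -oppr_le0.
apply: (@nonpos_of_bounded_growth _ (fun z => - (v z + 1))
  (fun z => - (((2 * d z + 2 * z) * v z + 2 * d z) / z))
  (nu ^+ 2 - 1 / 4) 1 _ _ _ _ x0).
- move=> z z0; have Hv := Dv z0.
  by apply: is_derive_eq; rewrite addr0.
- move=> z z0 vz; rewrite -mulNr ler_pdivlMr//.
  by have := d_ge0 z0; nra.
- move=> z z1; have z0 : 0 < z by lra.
  rewrite lerNl -lerBlDr /v ler_pdivlMr//.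
  by have := d_ge0 z0; have := c_ge0; nra.
Qed.

(** Strictness comes from Fermat's rule: a zero of [v] or of [v + 1] would be an
    extremum, and [Dv] computes the derivative of [v] there. *)
Lemma growing_riccati_slope (x : R) : 0 < x ->
  let s := (phi x ^+ 2 - 2 * nu * phi x - x ^+ 2) / x in
  0 < s <= 1 /\ (s = 1 <-> nu = 1 / 2).
Proof.
move=> x0 /=; rewrite slopeE//.
have Dv1 z : 0 < z -> derivable v z 1 by move=> /Dv[].
have Dmv z : 0 < z -> derivable (\- v) z 1.
  by move=> /Dv1; exact: derivableN.
split.
  rewrite lt_def u_ge0// andbT; apply/andP; split; last by have := v_le0 x0; lra.
  apply/eqP => ux.
  have := @derive_at_global_max _ (\- v) _ x x0 Dmv _ (is_deriveN (Dv x0)).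
  have -> : v x = -1 by lra.
  move=> H; suff : 2 = 0 :> R by lra.
  rewrite -{}H; first by field; exact: lt0r_neq0.
  by move=> z z0 /=; have := u_ge0 z0; lra.
split => [vx|nuE].
  have := @derive_at_global_max _ v _ x x0 Dv1 _ (Dv x0).
  have vx0 : v x = 0 by lra.
  rewrite vx0 mulr0 add0r => H.
  have /eqP : 2 * d x / x = 0 by apply: H => z z0; exact: v_le0.
  rewrite !mulf_eq0 invr_eq0 (gt_eqF x0) orbF pnatr_eq0 /= => /eqP dx0.
  move: vx0; rewrite /v dx0 mul0r sub0r => /eqP.
  rewrite mulf_eq0 invr_eq0 (gt_eqF x0) orbF oppr_eq0 => /eqP.
  by have := nu_ge; nra.
have d0 : d x = 0.
  apply/eqP; rewrite eq_le d_ge0// andbT.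
  apply: (@nonpos_of_bounded_growth _ d v B X _ _ _ _ x0); [exact: Dd| |exact: d_le].
  move=> z z0 dz; rewrite /v ler_pdivlMr// nuE; nra.
rewrite /v d0 nuE mul0r; field; exact: lt0r_neq0.
Qed.

End growing_riccati.

(** Here differences of solutions decay, so the inequalities propagate from the
    behaviour at [0], by [nonpos_of_decay]. *)
Section decaying_riccati.
Context {R : realType}.
Variables (nu : R) (phi : R -> R).
Hypothesis nu_ge : 1 / 2 <= nu.
Hypothesis Dphi : forall x : R, 0 < x ->
  is_derive x 1 phi ((x ^+ 2 + 2 * nu * phi x - phi x ^+ 2) / x).
Hypothesis phi_ge : forall x : R, 0 < x -> 2 * nu <= phi x.
Hypothesis phi_le : forall x : R, 0 < x ->
  phi x <= 2 * nu + x ^+ 2 / (2 * (nu + 1)).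

(* Here [d = 0] is the solution [phi = x] of the case [nu = 1 / 2];
   again [v] is both [derive1 d] and [derive1 phi - 1]. *)
Let d (x : R) := phi x - nu - x + 1 / 2.
Let v (x : R) := ((nu ^+ 2 - 1 / 4) - d x * (d x + 2 * x - 1)) / x.

Let slopeE (x : R) : 0 < x ->
  (x ^+ 2 + 2 * nu * phi x - phi x ^+ 2) / x = v x + 1.
Proof. by move=> x0; rewrite /v /d; field; exact: lt0r_neq0. Qed.

Let c_ge0 : 0 <= nu ^+ 2 - 1 / 4.
Proof. by have := nu_ge; nra. Qed.

Let Dd (x : R) : 0 < x -> is_derive x 1 d (v x).
Proof.
move=> x0; have Hphi := Dphi x0.
apply: is_derive_eq; rewrite /v /d /GRing.scale /=; field; exact: lt0r_neq0.
Qed.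

Let Dv (x : R) : 0 < x ->
  is_derive x 1 v (- ((2 * d x + 2 * x) * v x + 2 * d x) / x).
Proof.
move=> x0; have Hd := Dd x0.
have HQ : is_derive x 1
    (fun z => (nu ^+ 2 - 1 / 4) - d z * (d z + 2 * z - 1))
    (- ((2 * d x + 2 * x - 1) * v x + 2 * d x)).
  by apply: is_derive_eq; rewrite /GRing.scale /=; ring.
apply: (is_derive_eq (is_derive_div_id x0 HQ)).
by rewrite /v; field; exact: lt0r_neq0.
Qed.

Let cvg_id0 : x @[x --> (0 : R)^'+] --> (0 : R).
Proof. exact: cvg_at_right_filter cvg_id. Qed.

Let cvg_phi_sub_div : (phi x - 2 * nu) / x @[x --> (0 : R)^'+] --> (0 : R).
Proof.
apply: (@squeeze_cvgr _ _ _ _ (cst 0) (fun x => x / (2 * (nu + 1)))).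
- near=> x.
  have x0 : 0 < x by near: x; exact: nbhs_right_gt.
  rewrite divr_ge0 ?(ltW x0) ?subr_ge0 ?phi_ge//= ler_pdivrMr// lerBlDl.
  by rewrite mulrAC -expr2; exact: phi_le.
- exact: cvg_cst.
- by rewrite -[X in _ --> X](mul0r (2 * (nu + 1))^-1); apply: cvgMr_tmp.
Unshelve. all: by end_near. Qed.

Let cvg_phi : phi x @[x --> (0 : R)^'+] --> 2 * nu.
Proof.
have : (phi x - 2 * nu) / x * x + 2 * nu @[x --> (0 : R)^'+] --> 0 * 0 + 2 * nu.
  by apply: cvgD; [exact: cvgM|exact: cvg_cst].
rewrite mul0r add0r; apply: cvg_trans; apply: near_eq_cvg.
near=> x.
have x0 : 0 < x by near: x; exact: nbhs_right_gt.
by rewrite divfK ?subrK// gt_eqF.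
Unshelve. all: by end_near. Qed.

Let cvg_v : v x @[x --> (0 : R)^'+] --> (-1 : R).
Proof.
have : x - phi x * ((phi x - 2 * nu) / x) - 1 @[x --> (0 : R)^'+] -->
    0 - 2 * nu * 0 - 1.
  by apply: cvgB; [apply: cvgB => //; exact: cvgM|exact: cvg_cst].
rewrite mulr0 subr0 sub0r; apply: cvg_trans; apply: near_eq_cvg.
near=> x.
have x0 : 0 < x by near: x; exact: nbhs_right_gt.
by rewrite /v /d; field; exact: lt0r_neq0.
Unshelve. all: by end_near. Qed.

(* For [nu = 1 / 2], [d = 0] solves the equation for [d], so positivity has to
   be obtained by comparison with a positive subsolution: [expR (- (2 * x))] is
   one for every [nu >= 1 / 2]. *)
Let d_gt0 (x : R) : 0 < x -> 0 < d x.
Proof.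
move=> x0; apply: (@lt_le_trans _ _ (expR (- (2 * x)))); first exact: expR_gt0.
rewrite -subr_le0.
apply: (@nonpos_of_decay _ (fun z => expR (- (2 * z)) - d z)
  (fun z => - 2 * expR (- (2 * z)) - v z) (1 - (nu + 1 / 2)) _ _ _ _ _ x0).
- move=> z z0; have Hd := Dd z0.
  by apply: is_derive_eq; rewrite /GRing.scale /=; ring.
- (* With [h] the exponential and [f = h - d]: since [h <= 1],
     [z * derive1 f <= - f * (h + d + 2 * z - 1) - (nu ^+ 2 - 1 / 4)]. *)
  move=> z z0 hz; rewrite subr_le0 /v ler_pdivlMr//.
  have h1 : expR (- (2 * z)) <= 1 by rewrite -[leRHS]expR0 ler_expR; lra.
  have h0 := expR_gt0 (- (2 * z)).
  have : 0 <= d z + 2 * z - 1.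
    by have := phi_ge z0; have := nu_ge; rewrite /d; lra.
  by move: hz; set h := expR _ in h1 h0 *; have := c_ge0; nra.
- apply: cvgB.
    have E0 : expR (- (2 * 0)) = 1 :> R by rewrite mulr0 oppr0 expR0.
    rewrite -[X in _ --> X]E0.
    apply: continuous_cvg; first exact: continuous_expR.
    by apply: cvgN; apply: cvgM; [exact: cvg_cst|exact: cvg_id0].
  have -> : nu + 1 / 2 = 2 * nu - nu - 0 + 1 / 2 by lra.
  apply: cvgD; last exact: cvg_cst.
  apply: cvgB; last exact: cvg_id0.
  by apply: cvgB; [exact: cvg_phi|exact: cvg_cst].
- by have := nu_ge; lra.
Qed.

Let v_le0 (x : R) : 0 < x -> v x <= 0.
Proof.
move=> x0; apply: (@nonpos_of_decay _ v
  (fun z => - ((2 * d z + 2 * z) * v z + 2 * d z) / z) (-1) Dv _ cvg_v _ _ x0).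
  move=> z z0 vz; rewrite mulNr oppr_le0 divr_ge0 ?(ltW z0)//.
  by have := d_gt0 z0; nra.
by rewrite oppr_le0.
Qed.

Let u_ge0 (x : R) : 0 < x -> 0 <= v x + 1.
Proof.
move=> x0; rewrite -oppr_le0.
apply: (@nonpos_of_decay _ (fun z => - (v z + 1))
  (fun z => - (- ((2 * d z + 2 * z) * v z + 2 * d z) / z)) 0 _ _ _ _ _ x0).
- move=> z z0; have Hv := Dv z0.
  by apply: is_derive_eq; rewrite addr0.
- move=> z z0 vz; rewrite mulNr opprK ler_pdivrMr// mul0r.
  by have := d_gt0 z0; nra.
- have E : - (-1 + 1) = 0 :> R by lra.
  rewrite -[X in _ --> X]E.
  by apply: cvgN; apply: cvgD; [exact: cvg_v|exact: cvg_cst].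
- exact: lexx.
Qed.

Lemma decaying_riccati_slope (x : R) : 0 < x ->
  0 < (x ^+ 2 + 2 * nu * phi x - phi x ^+ 2) / x < 1.
Proof.
move=> x0; rewrite slopeE//.
have Dv1 z : 0 < z -> derivable v z 1 by move=> /Dv[].
have Dmv z : 0 < z -> derivable (\- v) z 1.
  by move=> /Dv1; exact: derivableN.
apply/andP; split.
  rewrite lt_def u_ge0// andbT; apply/eqP => ux.
  have := @derive_at_global_max _ (\- v) _ x x0 Dmv _ (is_deriveN (Dv x0)).
  have -> : v x = -1 by lra.
  move=> H; suff : -2 = 0 :> R by lra.
  rewrite -{}H; first by field; exact: lt0r_neq0.
  by move=> z z0 /=; have := u_ge0 z0; lra.
rewrite -ltrBrDr subrr lt_def v_le0// andbT eq_sym; apply/eqP => vx.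
have := @derive_at_global_max _ v _ x x0 Dv1 _ (Dv x0).
rewrite vx mulr0 add0r => H.
have /eqP : - (2 * d x) / x = 0 by apply: H => z z0; exact: v_le0.
rewrite mulf_eq0 invr_eq0 (gt_eqF x0) orbF oppr_eq0 => /eqP.
by have := d_gt0 x0; lra.
Qed.

End decaying_riccati.

(** * Expansions of the bounds *)

Section bound_root.
Context {R : realType}.
Variable nu : R.
Hypothesis nu_ge : 1 / 2 <= nu.

(** Both Riccati equations read [(phi - nu)^2 = nu^2 + x * (x + s)], where [s]
    is the slope of [phi] for the growing one and its opposite for the decaying
    one; this is their larger root. *)
Definition slope_root (x s : R) : R :=
  nu + Num.sqrt (nu ^+ 2 + x * (x + s)).

Lemma lower_bound_root (x : R) : lower_bound nu x = slope_root x (-1).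
Proof. by []. Qed.

Lemma upper_bound_root (x : R) : upper_bound nu x = slope_root x 1.
Proof. by []. Qed.

Lemma slope_root_lt (x s t : R) : 0 < x -> -1 <= s -> s < t ->
  slope_root x s < slope_root x t.
Proof.
move=> x0 s1 st; rewrite /slope_root ltrD2l ltr_sqrt ?ltrD2l ?ltr_pM2l ?ltrD2l//.
have n2 : 1 / 4 <= nu ^+ 2 by have := nu_ge; nra.
have xt : 0 < x * (t + 1) by rewrite mulr_gt0//; lra.
by have := sqr_ge0 (x - 1 / 2); lra.
Qed.

Lemma slope_rootE (x s y : R) : nu <= y -> (y - nu) ^+ 2 = nu ^+ 2 + x * (x + s) ->
  y = slope_root x s.
Proof.
move=> ny h; rewrite /slope_root -h sqrtr_sqr ger0_norm ?subr_ge0//.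
by rewrite addrC subrK.
Qed.

End bound_root.

Lemma cvg_inv_pinfty {R : realType} : x^-1 @[x --> +oo] --> (0 : R).
Proof.
apply/(@gtr0_cvgV0 R R _ _ id); last exact: cvg_id.
exact: nbhs_pinfty_gt.
Qed.

(** Multiplying by the conjugate turns the difference into [g - b^2 / 4] over
    [sqrt (x^2 + b x + g) + x + b / 2], and the latter is equivalent to [2 x]. *)
Lemma cvg_sqrt_quadratic {R : realType} (b g : R) :
  x * (Num.sqrt (x ^+ 2 + b * x + g) - x - b / 2) @[x --> +oo] -->
    (g - b ^+ 2 / 4) / 2.
Proof.
have cS : Num.sqrt (1 + b * x^-1 + g * (x^-1 * x^-1)) + 1 + b / 2 * x^-1
    @[x --> +oo] --> (1 + 1 + b / 2 * 0 : R).
  have cV := @cvg_inv_pinfty R.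
  apply: cvgD; last by apply: cvgM => //; exact: cvg_cst.
  apply: cvgD; last exact: cvg_cst.
  rewrite -[X in _ --> X]sqrtr1.
  apply: continuous_cvg; first exact: sqrt_continuous.
  have {2}-> : 1 = 1 + b * 0 + g * (0 * 0) :> R by ring.
  apply: cvgD; first by apply: cvgD; [exact: cvg_cst|apply: cvgM => //; exact: cvg_cst].
  by apply: cvgM; [exact: cvg_cst|exact: cvgM].
have h : (g - b ^+ 2 / 4)
    * (Num.sqrt (1 + b * x^-1 + g * (x^-1 * x^-1)) + 1 + b / 2 * x^-1)^-1
    @[x --> +oo] --> (g - b ^+ 2 / 4) / (1 + 1 + b / 2 * 0 : R).
  by apply: cvgM; [exact: cvg_cst|apply: cvgV => //; rewrite mulr0 addr0].
rewrite mulr0 addr0 in h.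
apply: cvg_trans h; apply: near_eq_cvg; near=> x.
have x0 : 0 < x by near: x; exact: nbhs_pinfty_gt.
(* Large enough for the radicand and the conjugate sum to be positive. *)
have xb : 1 + `|b| + `|g| < x by near: x; exact: nbhs_pinfty_gt.
set S := Num.sqrt (x ^+ 2 + _ + _).
have hb : - `|b| <= b by rewrite lerNl -normrN ler_norm.
have hg : - `|g| <= g by rewrite lerNl -normrN ler_norm.
have gb := normr_ge0 b; have gg := normr_ge0 g.
have q0 : 0 <= x ^+ 2 + b * x + g by nra.
have SE : S ^+ 2 = x ^+ 2 + b * x + g by rewrite sqr_sqrtr.
have S0 : 0 <= S by exact: sqrtr_ge0.
have TE : Num.sqrt (1 + b * x^-1 + g * (x^-1 * x^-1)) = S / x.
  have -> : 1 + b * x^-1 + g * (x^-1 * x^-1) = (S / x) ^+ 2.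
    by rewrite exprMn SE; field; exact: lt0r_neq0.
  by rewrite sqrtr_sqr ger0_norm// divr_ge0// ltW.
rewrite /= TE.
have D0 : 0 < S + x + b / 2 by lra.
have -> : S / x + 1 + b / 2 * x^-1 = (S + x + b / 2) / x.
  by field; exact: lt0r_neq0.
rewrite invf_div; apply: (mulIf (lt0r_neq0 D0)).
rewrite -[LHS]mulrA divfK ?lt0r_neq0//.
have -> : g = S ^+ 2 - x ^+ 2 - b * x by rewrite SE; ring.
by field.
Unshelve. all: by end_near. Qed.

(** The condition for the third term implies those for the first two, since it
    is stronger by factors of [x]. *)
Lemma first_terms_oo3 {R : realType} (phi r : R -> R) (b c : R) :
  (forall x : R, 0 < x -> phi x = x * r x) ->
  x * (phi x - x - b) @[x --> +oo] --> c ->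
  first_terms_oo 3 (nth 0 [:: 1; b; c]) r.
Proof.
move=> phiE h; have cV := @cvg_inv_pinfty R.
have xp : \forall x \near +oo, (0 : R) < x by exact: nbhs_pinfty_gt.
have h1 : x^-1 * (x * (phi x - x - b)) @[x --> +oo] --> 0 * c by exact: cvgM.
case=> [|[|[|//]]] _.
- have : x^-1 * (x^-1 * (x * (phi x - x - b))) + b * x^-1 @[x --> +oo] -->
      0 * (0 * c) + b * 0.
    by apply: cvgD; apply: cvgM => //; exact: cvg_cst.
  rewrite mul0r mulr0 add0r; apply: cvg_trans; apply: near_eq_cvg.
  near=> x; have x0 : 0 < x by near: x.
  rewrite !big_ord_recr big_ord0 /= add0r phiE//.
  by rewrite expr0 invr1 !mulr1; field; exact: lt0r_neq0.
- move: h1; rewrite mul0r; apply: cvg_trans; apply: near_eq_cvg.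
  near=> x; have x0 : 0 < x by near: x.
  rewrite !big_ord_recr big_ord0 /= add0r phiE//.
  by rewrite expr0 invr1 mulr1 expr1; field; exact: lt0r_neq0.
- have : x * (phi x - x - b) - c @[x --> +oo] --> c - c.
    by apply: cvgB => //; exact: cvg_cst.
  rewrite subrr; apply: cvg_trans; apply: near_eq_cvg.
  near=> x; have x0 : 0 < x by near: x.
  rewrite !big_ord_recr big_ord0 /= add0r phiE//.
  by rewrite expr0 invr1 mulr1 expr1; field; exact: lt0r_neq0.
Unshelve. all: by end_near. Qed.

Lemma first_terms_0_leading {R : realType} (phi r : R -> R) (l : R) : l != 0 ->
  (forall x : R, 0 < x -> phi x = x * r x) ->
  phi x @[x --> 0^'+] --> l ->
  first_terms_0 1 (fun=> l) (fun=> -1) (fun=> 0%N) r.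
Proof.
move=> l0 phiE h [|//] _; split => //.
have : phi x / l - 1 @[x --> 0^'+] --> l / l - 1.
  by apply: cvgB; [apply: cvgMr_tmp|exact: cvg_cst].
rewrite divff// subrr; apply: cvg_trans; apply: near_eq_cvg.
near=> x.
have x0 : 0 < x by near: x; exact: nbhs_right_gt.
rewrite big_ord_recr big_ord0 /= add0r /term0 phiE//.
rewrite powR_inv1 ?ltW// expr0 mulr1.
by field; rewrite l0 lt0r_neq0.
Unshelve. all: by end_near. Qed.

Section accuracy.
Context {R : realType}.
Variable nu : R.
Hypothesis nu_ge : 1 / 2 <= nu.

Lemma cvg_slope_root_0 (s : R) : slope_root nu x s @[x --> 0^'+] --> 2 * nu.
Proof.
have c0 : x @[x --> (0 : R)^'+] --> (0 : R) by exact: cvg_at_right_filter cvg_id.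
have -> : 2 * nu = nu + Num.sqrt (nu ^+ 2 + 0 * (0 + s)).
  by rewrite mul0r addr0 sqrtr_sqr ger0_norm; [ring|have := nu_ge; lra].
apply: cvgD; first exact: cvg_cst.
apply: continuous_cvg; first exact: sqrt_continuous.
apply: cvgD; first exact: cvg_cst.
by apply: cvgM => //; apply: cvgD => //; exact: cvg_cst.
Qed.

Lemma cvg_slope_root_oo (s : R) :
  x * (slope_root nu x s - x - (nu + s / 2)) @[x --> +oo] -->
    (nu ^+ 2 - s ^+ 2 / 4) / 2.
Proof.
have := @cvg_sqrt_quadratic R s (nu ^+ 2).
apply: cvg_trans; apply: near_eq_cvg.
near=> x; rewrite /slope_root.
have -> : nu ^+ 2 + x * (x + s) = x ^+ 2 + s * x + nu ^+ 2 by ring.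
ring.
Unshelve. all: by end_near. Qed.

End accuracy.

(** Inserting the bound of accuracy 3 at infinity for the order [nu + 1] in the
    recurrence that links the ratios of orders [nu] and [nu + 1] gives the
    opposite bound for the order [nu], here for both kinds at once ([s = 1] for
    the second kind, [s = -1] for the first). It has the same three terms as
    [slope_root nu x s], although the recurrence divides by [x + s]: the
    coefficients for [nu + 1] are shifted by exactly what that division costs. *)
Lemma cvg_recurrence_bound {R : realType} (nu s : R) : s ^+ 2 = 1 ->
  x * (x / (x + s) * (slope_root (nu + 1) x s - (nu + 1) + s * (nu + 1))
       + (nu - s * nu) - x - (nu + s / 2))
    @[x --> +oo] --> (nu ^+ 2 - s ^+ 2 / 4) / 2.
Proof.
move=> s2; have cV := @cvg_inv_pinfty R.
have cs : (1 + s * x^-1)^-1 @[x --> +oo] --> (1 + s * 0)^-1.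
  apply: cvgV; first by rewrite mulr0 addr0 oner_neq0.
  apply: cvgD; first exact: cvg_cst.
  by apply: cvgM => //; exact: cvg_cst.
have : (x * (slope_root (nu + 1) x s - x - (nu + 1 + s / 2)) - (nu + 1 / 2))
    * (1 + s * x^-1)^-1 @[x --> +oo] -->
    (((nu + 1) ^+ 2 - s ^+ 2 / 4) / 2 - (nu + 1 / 2)) * (1 + s * 0)^-1.
  apply: cvgM => //; apply: cvgB; last exact: cvg_cst.
  exact: cvg_slope_root_oo.
have -> : (((nu + 1) ^+ 2 - s ^+ 2 / 4) / 2 - (nu + 1 / 2)) * (1 + s * 0)^-1 =
    (nu ^+ 2 - s ^+ 2 / 4) / 2.
  by rewrite mulr0 addr0 invr1; field.
apply: cvg_trans; apply: near_eq_cvg; near=> x.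
have x0 : 0 < x by near: x; exact: nbhs_pinfty_gt.
have xs : 0 < x + s.
  have : `|s| < x by near: x; exact: nbhs_pinfty_gt.
  by have := ler_norm (- s); rewrite normrN; lra.
set S := slope_root _ _ _.
have -> : 1 + s * x^-1 = (x + s) / x by field; exact: lt0r_neq0.
rewrite invf_div.
apply: (mulIf (lt0r_neq0 xs)).
have /eqP := s2; rewrite sqrf_eq1 => /orP[] /eqP sE;
  by rewrite sE in xs *; field; rewrite lt0r_neq0//; lra.
Unshelve. all: by end_near. Qed.

(** * Integrals of exponentially decreasing functions *)

Section half_line_integral.
Context {R : realType}.
Local Notation mu := (@lebesgue_measure R).
Local Notation halfline := (`[0, +oo[%classic : set R).

Lemma measurable_fun_halfline (f : R -> R) :
  {within halfline, continuous f} -> measurable_fun halfline f.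
Proof.
by move=> cf; exact: subspace_continuous_measurable_fun.
Qed.

Lemma integrable_expRN (b : R) : 0 < b ->
  mu.-integrable halfline (EFin \o (fun t => expR (- (b * t)))).
Proof.
move=> b0.
have H : mu.-integrable halfline (EFin \o exponential_pdf b).
  apply: (integrableS measurableT) => //; exact: integrable_exponential_pdf.
have := @integrableZl _ _ _ mu halfline (measurable_itv _) b^-1 _ H.
apply: eq_integrable => // t; rewrite inE/= in_itv/= andbT => t0.
by rewrite exponential_pdfE//= -EFinM mulKf ?lt0r_neq0// mulNr.
Qed.

Lemma integrable_exp_dominated (f : R -> R) (M b : R) : 0 < b ->
  {within halfline, continuous f} ->
  (forall t, 0 <= t -> `|f t| <= M * expR (- (b * t))) ->
  mu.-integrable halfline (EFin \o f).
Proof.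
move=> b0 cf fM.
apply: (@le_integrable _ _ _ mu halfline (measurable_itv _) (EFin \o f)
  (fun t => M%:E * (expR (- (b * t)))%:E)%E).
- by apply/measurable_EFinP; exact: measurable_fun_halfline.
- move=> t /=; rewrite in_itv/= andbT => t0.
  by rewrite lee_fin (le_trans (fM _ t0))// ler_norm.
- exact: (@integrableZl _ _ _ mu halfline (measurable_itv _) M _ (integrable_expRN b0)).
Qed.

Lemma cvg_expRN_pinfty (b : R) : 0 < b ->
  expR (- (b * t)) @[t --> +oo] --> (0 : R).
Proof.
move=> b0; apply: (@cvg_comp _ _ _ _ (fun z => expR (- z)) _ (pinfty_nbhs R)).
  exact: gt0_cvgMry.
exact: cvgr_expR.
Qed.

(** For a nonnegative integrand this is monotone convergence. An integrand
    [f] without sign becomes nonnegative after adding the exponential [g] that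
    dominates it, and the primitive [G] of [g] is explicit. *)
Lemma Rintegral_halfline_FTC (f F : R -> R) (M b : R) : 0 < b ->
  {within halfline, continuous f} ->
  (forall t, 0 <= t -> `|f t| <= M * expR (- (b * t))) ->
  F x @[x --> +oo] --> (0 : R) -> F x @[x --> 0^'+] --> F 0 ->
  (forall t : R, 0 < t -> is_derive t 1 F (f t)) ->
  Rintegral mu halfline f = - F 0.
Proof.
move=> b0 cf fM Foo F0 DF.
pose g (t : R) := M * expR (- (b * t)).
pose G (t : R) := - (M / b * expR (- (b * t))).
have DG (t : R) : is_derive t 1 G (g t).
  by apply: is_derive_eq; rewrite /G /g /GRing.scale /=; field; exact: lt0r_neq0.
have cg : {within halfline, continuous g}.
  apply: continuous_subspaceT => t.
  have Dg : is_derive t 1 g (- b * g t).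
    by apply: is_derive_eq; rewrite /g /GRing.scale /=; ring.
  exact: is_derive_continuous Dg.
have ig : mu.-integrable halfline (EFin \o g).
  apply: (integrable_exp_dominated (M := M) b0 cg) => t t0.
  by have g0 := le_trans (normr_ge0 _) (fM _ t0); rewrite ger0_norm.
have iF : mu.-integrable halfline (EFin \o f).
  exact: integrable_exp_dominated fM.
have Goo : G x @[x --> +oo] --> (0 : R).
  rewrite -oppr0 -(mulr0 (M / b)); apply: cvgN; apply: cvgM.
    exact: cvg_cst.
  exact: cvg_expRN_pinfty.
have G0 : G x @[x --> 0^'+] --> G 0.
  by apply/cvg_at_right_filter; exact: is_derive_continuous (DG 0).
have Eg : Rintegral mu halfline g = 0 - G 0.
  apply: Rintegral_ge0_continuous_FTC2y => //.
  - by move=> t t0; exact: le_trans (normr_ge0 _) (fM _ t0).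
  - by move=> t _; rewrite derive1E; case: (DG t).
have Efg : Rintegral mu halfline (f \+ g) = (0 + 0) - (F 0 + G 0).
  apply: (@Rintegral_ge0_continuous_FTC2y _ (f \+ g) (F \+ G)).
  - move=> t t0 /=; have := fM _ t0; rewrite ler_norml => /andP[+ _].
    by rewrite -subr_ge0 opprK.
  - by move=> t; apply: continuousD; [exact: cf|exact: cg].
  - exact: cvgD.
  - by move=> t t0; have Hf := DF _ t0; have Hg := DG t; case: (is_deriveD Hf Hg).
  - exact: cvgD.
  - move=> t; rewrite in_itv/= andbT => t0; rewrite derive1E.
    by have Hf := DF _ t0; have Hg := DG t; case: (is_deriveD Hf Hg).
move: Efg; rewrite RintegralD//; rewrite Eg; lra.
Qed.

(** On the compact interval [1, 2] the integrand has a positive minimum, which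
    is a lower bound for the integral because the interval has length 1. *)
Lemma Rintegral_halfline_gt0 (f : R -> R) :
  {within halfline, continuous f} -> mu.-integrable halfline (EFin \o f) ->
  (forall t, 0 <= t -> 0 <= f t) -> (forall t, 0 < t -> 0 < f t) ->
  0 < Rintegral mu halfline f.
Proof.
move=> cf intf f_ge0 f_gt0.
have sub12 : `[1, 2]%classic `<=` halfline.
  by move=> t /=; rewrite !in_itv/= andbT => /andP[t1 _]; exact: le_trans t1.
have cf12 : {within `[1, 2], continuous f} by exact: continuous_subspaceW cf.
have [c] := EVT_min (ler_wpDl ler01 (lexx 1)) cf12.
rewrite in_itv/= => /andP[c1 _] fc.
have fc0 : 0 < f c by apply: f_gt0; exact: lt_le_trans c1.
apply: (lt_le_trans fc0); rewrite -lee_fin /Rintegral fineK; last first.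
  exact: integrable_fin_num.
apply: (@le_trans _ _ (\int[mu]_(t in `[1%R, 2%R]) (f t)%:E)%E); last first.
  apply: ge0_subset_integral => //.
    by apply/measurable_EFinP; exact: measurable_fun_halfline.
  by move=> t /=; rewrite in_itv/= andbT lee_fin; exact: f_ge0.
have -> : (f c)%:E = (\int[mu]_(t in `[1%R, 2%R]) (f c)%:E)%E.
  rewrite integral_cst//= lebesgue_measure_itv/= lte_fin ltr1n/= -EFinB -EFinM.
  by congr EFin; ring.
apply: ge0_le_integral => //.
- by move=> t _; rewrite lee_fin ltW.
- by apply/measurable_EFinP; apply: measurable_funS (measurable_fun_halfline cf).
Qed.

(** Raise [y / (p / c) <= expR (y / (p / c))] to the power [p]. *)
Lemma powR_le_expR (p c y : R) : 0 < p -> 0 < c -> 0 <= y ->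
  y `^ p <= (p / c) `^ p * expR (c * y).
Proof.
move=> p0 c0 y0; have a0 : 0 < p / c by exact: divr_gt0.
have -> : c * y = y / (p / c) * p by field; rewrite !lt0r_neq0.
rewrite expRM -powRM ?expR_ge0 ?(ltW a0)//.
apply: ge0_ler_powR; rewrite ?nnegrE ?mulr_ge0 ?expR_ge0 ?(ltW a0) ?(ltW p0)//.
  by rewrite invr_ge0 ltW.
rewrite mulrC -ler_pdivrMr//.
by apply: le_trans (expR_ge1Dx _); rewrite lerDr.
Qed.

End half_line_integral.

(** * The functional equation of 1 / Gamma *)

Section gamma_function.
Context {R : realType}.
Local Notation mu := (@lebesgue_measure R).
Local Notation halfline := (`[0, +oo[%classic : set R).

Definition gamma_integrand (p t : R) : R := t `^ p * expR (- t).

Lemma is_derive_gamma_integrand (p t : R) : 0 < t ->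
  is_derive t 1 (gamma_integrand p)
    (p * gamma_integrand (p - 1) t - gamma_integrand p t).
Proof.
move=> t0; have Hp := is_derive1_powR p t0.
have He : is_derive t 1 (fun z : R => expR (- z)) (- expR (- t)).
  by apply: is_derive_eq; rewrite /GRing.scale /=; ring.
apply: (is_derive_eq (is_deriveM Hp He)).
by rewrite /gamma_integrand /GRing.scale /=; ring.
Qed.

Lemma gamma_integrand_cvg0 (p : R) : 0 <= p ->
  gamma_integrand p t @[t --> 0^'+] --> gamma_integrand p 0.
Proof.
move=> p0; apply: cvgM.
  have [->|pn0] := eqVneq p 0.
    by rewrite powRr0; apply: cvg_near_cst; near=> t; rewrite powRr0.
  by rewrite powR0//; apply: powR_cvg0; rewrite lt_def pn0.
apply: cvg_at_right_filter; apply: continuous_comp; last exact: continuous_expR.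
exact: oppr_continuous.
Unshelve. all: by end_near. Qed.

Lemma gamma_integrand_continuous (p : R) : 0 <= p ->
  {within halfline, continuous (gamma_integrand p)}.
Proof.
move=> p0; apply/continuous_within_itvcyP; split; last exact: gamma_integrand_cvg0.
move=> t; rewrite in_itv/= andbT => t0.
exact: is_derive_continuous (is_derive_gamma_integrand p t0).
Qed.

Lemma gamma_integrand_bound (p : R) : 0 <= p ->
  exists M, forall t : R, 0 <= t ->
    `|gamma_integrand p t| <= M * expR (- (1 / 2 * t)).
Proof.
move=> p0; have h M : (forall t : R, 0 <= t -> t `^ p <= M * expR (1 / 2 * t)) ->
    forall t : R, 0 <= t -> `|gamma_integrand p t| <= M * expR (- (1 / 2 * t)).
  move=> hM t t0; rewrite ger0_norm ?mulr_ge0 ?powR_ge0 ?expR_ge0//.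
  have -> : - (1 / 2 * t) = 1 / 2 * t - t by field.
  by rewrite expRD mulrA /gamma_integrand ler_wpM2r ?expR_ge0 ?hM.
have [pE|pn0] := eqVneq p 0.
  exists 1; apply: h => t t0; rewrite pE powRr0 mul1r -[leLHS]expR0 ler_expR.
  by rewrite mulr_ge0.
exists ((p / (1 / 2)) `^ p); apply: h => t t0.
by apply: powR_le_expR => //; rewrite lt_def pn0.
Qed.

Lemma integrable_gamma_integrand (p : R) : 0 <= p ->
  mu.-integrable halfline (EFin \o gamma_integrand p).
Proof.
move=> p0; have [M hM] := gamma_integrand_bound p0.
by apply: integrable_exp_dominated hM => //; exact: gamma_integrand_continuous.
Qed.

(** For [1 <= s] the integrand is continuous up to [0], so the closed half line
    may replace the open one. The arguments of [Gamma] that occur in [invGamma s]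
    with [0 < s] are all at least 1. *)
Lemma GammaE (s : R) : 1 <= s ->
  Gamma s = Rintegral mu halfline (gamma_integrand (s - 1)).
Proof.
move=> s1; rewrite /Gamma -Rintegral_itv_obnd_cbnd//.
apply: (@integrableS _ _ _ mu halfline) => //.
  by move=> t /=; rewrite !in_itv/= !andbT; exact: ltW.
by apply: integrable_gamma_integrand; rewrite subr_ge0.
Qed.

Lemma Gamma_gt0 (s : R) : 1 <= s -> 0 < Gamma s.
Proof.
move=> s1; have s0 : 0 <= s - 1 by rewrite subr_ge0.
rewrite GammaE//; apply: Rintegral_halfline_gt0.
- exact: gamma_integrand_continuous.
- exact: integrable_gamma_integrand.
- by move=> t _; rewrite mulr_ge0 ?powR_ge0 ?expR_ge0.
- by move=> t t0; rewrite mulr_gt0 ?powR_gt0 ?expR_gt0.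
Qed.

(** Integration by parts: [t^s * exp (- t)] vanishes at both ends. *)
Lemma GammaS (s : R) : 1 <= s -> Gamma (s + 1) = s * Gamma s.
Proof.
move=> s1; have s0 : 0 < s by lra.
have sm1 : 0 <= s - 1 by lra.
have ss : s + 1 - 1 = s by rewrite addrK.
rewrite !GammaE ?ss//; last by lra.
have [M0 hM0] := gamma_integrand_bound sm1.
have [M1 hM1] := gamma_integrand_bound (ltW s0).
pose f t := s * gamma_integrand (s - 1) t - gamma_integrand s t.
have i0 := integrable_gamma_integrand sm1.
have i1 := integrable_gamma_integrand (ltW s0).
have is0 : mu.-integrable halfline (EFin \o (fun t => s * gamma_integrand (s - 1) t)).
  exact: (@integrableZl _ _ _ mu halfline (measurable_itv _) s _ i0).
have : Rintegral mu halfline f = - gamma_integrand s 0.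
  apply: (@Rintegral_halfline_FTC _ f (gamma_integrand s) (s * M0 + M1) (1 / 2)) => //.
  - move=> t; apply: cvgB; last exact: gamma_integrand_continuous (ltW s0) t.
    by apply: cvgM; [exact: cvg_cst|exact: gamma_integrand_continuous sm1 t].
  - move=> t t0; apply: (le_trans (ler_normB _ _)).
    rewrite mulrDl normrM (ger0_norm (ltW s0)) -mulrA.
    by apply: lerD; [rewrite ler_pM2l// hM0|rewrite hM1].
  - apply: (@squeeze_cvgr _ _ _ _ (cst 0) (fun t => M1 * expR (- (1 / 2 * t)))).
    + near=> t.
      have t0 : 0 <= t by near: t; exact: nbhs_pinfty_ge.
      by rewrite mulr_ge0 ?powR_ge0 ?expR_ge0//=; apply: le_trans (ler_norm _) (hM1 _ t0).
    + exact: cvg_cst.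
    + by rewrite -(mulr0 M1); apply: cvgM; [exact: cvg_cst|exact: cvg_expRN_pinfty].
  - exact: gamma_integrand_cvg0 (ltW s0).
  - by move=> t; exact: is_derive_gamma_integrand.
rewrite /f RintegralB// RintegralZl// {3}/gamma_integrand powR0 ?lt0r_neq0//.
by rewrite mul0r oppr0 => /eqP; rewrite subr_eq0 => /eqP ->.
Unshelve. all: by end_near. Qed.

(** The expression in the definition of [invGamma] with an arbitrary number [N] of
    shifts; by [GammaS] it is the same for all positive [N]. *)
Let invGamma_at (s : R) (N : nat) : R :=
  (\prod_(i < N) (s + i%:R)) / Gamma (s + N%:R).

Let invGamma_atS (s : R) (N : nat) : 0 < s ->
  invGamma_at s N.+1 = invGamma_at s 1.
Proof.
move=> s0; elim: N => // N <-; rewrite /invGamma_at big_ord_recr /=.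
have sN : 1 <= s + N.+1%:R by rewrite -natr1; have := ler0n R N; lra.
have -> : s + N.+2%:R = (s + N.+1%:R) + 1 by rewrite -addrA natr1.
rewrite GammaS//; have := Gamma_gt0 sN => G0.
by field; rewrite !lt0r_neq0//; lra.
Qed.

Let invGammaE (s : R) : 0 < s -> invGamma s = invGamma_at s 1.
Proof.
move=> s0; rewrite /invGamma.
have : (0 < Num.bound s)%N.
  by rewrite -(ltr0n R); apply: lt_trans (archi_boundP (ltW s0)).
by case: (Num.bound s) => // N _; exact: invGamma_atS.
Qed.

Lemma invGamma_gt0 (s : R) : 0 < s -> 0 < invGamma s.
Proof.
move=> s0; rewrite invGammaE// /invGamma_at big_ord_recr big_ord0 /= mul1r addr0.
by rewrite divr_gt0// Gamma_gt0//; lra.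
Qed.

Lemma invGammaS (s : R) : 0 < s -> invGamma s = s * invGamma (s + 1).
Proof.
move=> s0; rewrite !invGammaE//; last by lra.
rewrite -(invGamma_atS 1 s0) /invGamma_at !big_ord_recr !big_ord0 /=.
have -> : s + 1 + 1%:R = s + 2%:R by rewrite -addrA.
by rewrite !mul1r !addr0 mulrA.
Qed.

End gamma_function.

(** * The function phi_minus: power series *)

Section besselI_series.
Context {R : realType}.

(** All that matters about [1 / Gamma] is that it is a positive solution of the
    functional equation [g s = s * g (s + 1)]. *)
Variable g : R -> R.
Hypothesis g_gt0 : forall s, 0 < s -> 0 < g s.
Hypothesis gS : forall s, 0 < s -> g s = s * g (s + 1).

Definition besselI_coef (nu : R) (k : nat) : R :=
  g (k%:R + nu + 1) / k`!%:R.

(** With [g = 1 / Gamma], [besselI nu x] is [(x / 2)^nu] times this entire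
    function at [(x / 2)^2]. *)
Definition besselI_entire (nu z : R) : R := limn (pseries (besselI_coef nu) z).

Let arg_gt0 (nu : R) k : -1 / 2 <= nu -> 0 < k%:R + nu + 1.
Proof. by move=> n0; have := ler0n R k; lra. Qed.

Lemma besselI_coef_gt0 (nu : R) k : -1 / 2 <= nu -> 0 < besselI_coef nu k.
Proof.
by move=> n0; rewrite divr_gt0 ?g_gt0 ?arg_gt0// ltr0n fact_gt0.
Qed.

(** The factor 2 bounds [1 / s] for the arguments [s >= 1 / 2] that occur. *)
Lemma besselI_coef_le (nu : R) k : -1 / 2 <= nu ->
  besselI_coef nu k <= g (nu + 1) * (2 ^+ k / k`!%:R).
Proof.
move=> n0; rewrite /besselI_coef [leRHS]mulrA.
have f0 : 0 < k`!%:R^-1 :> R by rewrite invr_gt0 ltr0n fact_gt0.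
rewrite (ler_pM2r f0) {f0}.
elim: k => [|k IHk]; first by rewrite add0r expr0 mulr1.
have a0 := arg_gt0 k n0.
rewrite exprS mulrCA.
apply: (le_trans _ (_ : 2 * g (k%:R + nu + 1) <= _)); last by rewrite ler_pM2l.
have -> : k.+1%:R + nu + 1 = k%:R + nu + 1 + 1 by rewrite -natr1; ring.
have a1 : 0 < k%:R + nu + 1 + 1 by lra.
rewrite (gS a0); have := g_gt0 a1; have := ler0n R k; nra.
Qed.

Lemma is_cvg_besselI_series (nu z : R) : -1 / 2 <= nu ->
  cvgn (pseries (besselI_coef nu) z).
Proof.
move=> n0; apply: normed_cvg.
apply: (@series_le_cvg _ _ (fun k => g (nu + 1) * exp_coeff (2 * `|z|) k)).
- by move=> k; rewrite normr_ge0.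
- move=> k; have g0 : 0 < g (nu + 1) by apply: g_gt0; lra.
  by rewrite mulr_ge0 ?(ltW g0) ?exp_coeff_ge0 ?mulr_ge0.
- move=> k; rewrite /= normrM normrX (ger0_norm (ltW (besselI_coef_gt0 _ n0))).
  have -> : g (nu + 1) * exp_coeff (2 * `|z|) k =
      g (nu + 1) * (2 ^+ k / k`!%:R) * `|z| ^+ k.
    by rewrite /exp_coeff /= exprMn -!mulrA (mulrC (`|z| ^+ k)).
  by rewrite ler_wpM2r ?exprn_ge0// besselI_coef_le.
- by apply: is_cvg_seriesZ; exact: is_cvg_series_exp_coeff.
Qed.

Lemma besselI_coef_diffs (nu : R) :
  pseries_diffs (besselI_coef nu) = besselI_coef (nu + 1).
Proof.
apply/funext => k; rewrite /pseries_diffs /besselI_coef factS natrM.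
have -> : k.+1%:R + nu + 1 = k%:R + (nu + 1) + 1 by rewrite -natr1; ring.
by rewrite invfM mulrCA mulVKf// pnatr_eq0.
Qed.

Lemma is_derive_besselI_entire (nu z : R) : -1 / 2 <= nu ->
  is_derive z 1 (besselI_entire nu) (besselI_entire (nu + 1) z).
Proof.
move=> n0; rewrite /besselI_entire -besselI_coef_diffs.
apply: (@pseries_snd_diffs _ _ (`|z| + 1)); rewrite ?besselI_coef_diffs.
- exact: is_cvg_besselI_series.
- by apply: is_cvg_besselI_series; lra.
- by apply: is_cvg_besselI_series; lra.
- by rewrite [ltRHS]ger0_norm ?addr_ge0// ltrDl.
Qed.

Lemma besselI_entire_gt0 (nu z : R) : -1 / 2 <= nu -> 0 <= z ->
  0 < besselI_entire nu z.
Proof.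
move=> n0 z0; apply: (lt_le_trans (besselI_coef_gt0 0 n0)).
apply: limr_ge; first exact: is_cvg_besselI_series.
near=> n.
have n1 : (0 < n)%N by near: n; exact: nbhs_infty_gt.
rewrite /pseries /series /= big_ltn// expr0 mulr1 lerDl sumr_ge0// => k _.
by rewrite mulr_ge0 ?exprn_ge0// ltW// besselI_coef_gt0.
Unshelve. all: by end_near. Qed.

(** The three-term recurrence of the Bessel functions. On coefficients it is
    [g] at [k + nu] being [k + nu] times [g] at [k + nu + 1]: the part [k] of
    this factor shortens the factorial and gives the term in [nu + 1]. *)
Lemma besselI_entire_rec (nu z : R) : 1 / 2 <= nu ->
  besselI_entire (nu - 1) z =
  z * besselI_entire (nu + 1) z + nu * besselI_entire nu z.
Proof.
move=> n0.
have c0 : cvgn (pseries (besselI_coef (nu - 1)) z).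
  by apply: is_cvg_besselI_series; lra.
have c1 : cvgn (pseries (besselI_coef nu) z).
  by apply: is_cvg_besselI_series; lra.
have c2 : cvgn (pseries (besselI_coef (nu + 1)) z).
  by apply: is_cvg_besselI_series; lra.
have E n : pseries (besselI_coef (nu - 1)) z n.+1 =
    z * pseries (besselI_coef (nu + 1)) z n + nu * pseries (besselI_coef nu) z n.+1.
  elim: n => [|n IHn].
    rewrite /pseries /series /= !big_nat1 big_geq// mulr0 add0r expr0 !mulr1.
    rewrite /besselI_coef !add0r subrK gS; last by lra.
    by rewrite mulrA.
  rewrite /pseries /series /= in IHn *.
  rewrite big_nat_recr//= {}IHn [in RHS]big_nat_recr//=.
  rewrite [\sum_(0 <= i < n.+2) _]big_nat_recr//=.
  suff -> : besselI_coef (nu - 1) n.+1 * z ^+ n.+1 =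
      z * (besselI_coef (nu + 1) n * z ^+ n)
      + nu * (besselI_coef nu n.+1 * z ^+ n.+1) by ring.
  rewrite /besselI_coef -natr1.
  have -> : n%:R + 1 + (nu - 1) + 1 = n%:R + nu + 1 by ring.
  have -> : n%:R + (nu + 1) + 1 = n%:R + nu + 1 + 1 by ring.
  have -> : n%:R + 1 + nu + 1 = n%:R + nu + 1 + 1 by ring.
  rewrite (gS (arg_gt0 _ _)); last by lra.
  rewrite factS natrM -natr1 exprS; field.
  by rewrite natr1 !pnatr_eq0 -lt0n fact_gt0.
apply/cvg_lim => //; rewrite -cvg_shiftS /= (funext E).
apply: cvgD; apply: cvgM; try exact: cvg_cst; first exact: c2.
by rewrite cvg_shiftS.
Qed.

End besselI_series.

Section phi_minus.
Context {R : realType}.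
Local Notation besselI_entire := (besselI_entire (@invGamma R)).
Local Notation besselI_coef := (besselI_coef (@invGamma R)).

Let cvg_series := is_cvg_besselI_series (@invGamma_gt0 R) (@invGammaS R).
Let entire_gt0 := besselI_entire_gt0 (@invGamma_gt0 R) (@invGammaS R).
Let derive_entire :=
  is_derive_besselI_entire (@invGamma_gt0 R) (@invGammaS R).
Let entire_rec := besselI_entire_rec (@invGamma_gt0 R) (@invGammaS R).

Lemma besselIE (nu x : R) : -1 / 2 <= nu -> 0 < x ->
  besselI nu x = (x / 2) `^ nu * besselI_entire nu ((x / 2) ^+ 2).
Proof.
move=> n0 x0; have x2 : 0 < x / 2 by rewrite divr_gt0.
rewrite /besselI /besselI_entire; apply/cvg_lim => //.
have -> : series (fun k : nat =>
    (x / 2) `^ (k.*2%:R + nu) * invGamma (k%:R + nu + 1) / k`!%:R) =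
    (fun n => (x / 2) `^ nu * pseries (besselI_coef nu) ((x / 2) ^+ 2) n).
  apply/funext => n; rewrite /pseries /series /= mulr_sumr.
  apply: eq_bigr => k _; rewrite powRD; last by rewrite (lt0r_neq0 x2) implybT.
  rewrite powR_mulrn ?(ltW x2)// -exprM mul2n /besselI_coef.
  by rewrite -!mulrA mulrC -!mulrA; congr (_ * _); rewrite mulrC -!mulrA.
by apply: cvgM; [exact: cvg_cst|exact: cvg_series].
Qed.

(** The powers of [x] cancel, so [phi_minus] is a quotient of entire functions of
    [(x / 2)^2], and every property of it comes from [besselI_entire]. *)
Lemma phi_minusE (nu x : R) : 1 / 2 <= nu -> 0 < x ->
  phi_minus nu x = 2 * besselI_entire (nu - 1) ((x / 2) ^+ 2)
                     / besselI_entire nu ((x / 2) ^+ 2).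
Proof.
move=> n0 x0; have x2 : 0 < x / 2 by rewrite divr_gt0.
have q0 : 0 < besselI_entire nu ((x / 2) ^+ 2).
  by apply: entire_gt0; [lra|rewrite sqr_ge0].
rewrite /phi_minus /ratioI !besselIE//; [|lra|lra].
have -> : (x / 2) `^ nu = (x / 2) `^ (nu - 1) * (x / 2).
  by rewrite -{3}(powRr1 (ltW x2)) -powRD ?subrK// (lt0r_neq0 x2) implybT.
have p0 : 0 < (x / 2) `^ (nu - 1) by rewrite powR_gt0.
move: q0 p0; move: (besselI_entire nu _) (besselI_entire (nu - 1) _) => B A.
by move: (_ `^ _) => P q0 p0; field; rewrite !lt0r_neq0.
Qed.

Lemma phi_minus_gt0 (nu x : R) : 1 / 2 <= nu -> 0 < x -> 0 < phi_minus nu x.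
Proof.
by move=> n0 x0; rewrite phi_minusE// divr_gt0 ?mulr_gt0//
  entire_gt0 ?sqr_ge0//; lra.
Qed.

Lemma phi_minus_rec (nu x : R) : 1 / 2 <= nu -> 0 < x ->
  phi_minus nu x = 2 * nu + x ^+ 2 / phi_minus (nu + 1) x.
Proof.
move=> n0 x0; have n1 : 1 / 2 <= nu + 1 by lra.
rewrite !phi_minusE// addrK entire_rec//.
have q0 : 0 < besselI_entire nu ((x / 2) ^+ 2).
  by apply: entire_gt0; [lra|rewrite sqr_ge0].
have q1 : 0 < besselI_entire (nu + 1) ((x / 2) ^+ 2).
  by apply: entire_gt0; [lra|rewrite sqr_ge0].
move: q0 q1; move: (besselI_entire nu _) (besselI_entire (nu + 1) _) => B E q0 q1.
by field; rewrite !lt0r_neq0.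
Qed.

(** Numerator and denominator have orders [nu - 1] and [nu]; differentiating the
    latter brings in the order [nu + 1], which the recurrence eliminates. *)
Lemma is_derive_phi_minus (nu x : R) : 1 / 2 <= nu -> 0 < x ->
  is_derive x 1 (phi_minus nu)
    ((x ^+ 2 + 2 * nu * phi_minus nu x - phi_minus nu x ^+ 2) / x).
Proof.
move=> n0 x0.
apply: (@near_eq_is_derive _ _ _ (fun x : R => 2 *
    (besselI_entire (nu - 1) ((x / 2) ^+ 2) / besselI_entire nu ((x / 2) ^+ 2)))).
  near=> z; rewrite phi_minusE ?mulrA//.
  by near: z; exact: lt_nbhsr.
have q0 : 0 < besselI_entire nu ((x / 2) ^+ 2).
  by apply: entire_gt0; [lra|rewrite sqr_ge0].
have Hz : is_derive x 1 (fun x : R => (x / 2) ^+ 2) (x / 2).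
  by apply: is_derive_eq; rewrite /GRing.scale /=; field.
have nm : - 1 / 2 <= nu - 1 by lra.
have np : - 1 / 2 <= nu by lra.
have HA := @is_derive1_comp _ (besselI_entire (nu - 1)) (fun x : R => (x / 2) ^+ 2) x _ _
  (derive_entire ((x / 2) ^+ 2) nm) Hz.
have HB := @is_derive1_comp _ (besselI_entire nu) (fun x : R => (x / 2) ^+ 2) x _ _
  (derive_entire ((x / 2) ^+ 2) np) Hz.
have HV := @is_deriveV _ (fun x : R => besselI_entire nu ((x / 2) ^+ 2)) x _ 1
  (lt0r_neq0 q0) HB.
apply: (is_derive_eq (is_deriveZ 2 (is_deriveM HA HV))).
rewrite phi_minusE// subrK /GRing.scale /= entire_rec//.
move: q0; move: (besselI_entire nu _) (besselI_entire (nu + 1) _) => B E q0.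
by field; rewrite !lt0r_neq0.
Unshelve. all: by end_near. Qed.

End phi_minus.

(** * The function phi_plus: integral representation *)

Section hyperbolic.
Context {R : realType}.

Definition sinh (t : R) : R := (expR t - expR (- t)) / 2.

Lemma is_derive_cosh (t : R) : is_derive t 1 (@cosh R) (sinh t).
Proof.
by apply: is_derive_eq; rewrite /sinh /GRing.scale /=; field.
Qed.

Lemma is_derive_sinh (t : R) : is_derive t 1 sinh (cosh t).
Proof.
by apply: is_derive_eq; rewrite /cosh /GRing.scale /=; field.
Qed.

Lemma coshD (s t : R) : cosh (s + t) = cosh s * cosh t + sinh s * sinh t.
Proof. by rewrite /cosh /sinh opprD !expRD; field. Qed.

Lemma coshB (s t : R) : cosh (s - t) = cosh s * cosh t - sinh s * sinh t.
Proof. by rewrite /cosh /sinh opprD opprK !expRD; field. Qed.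

Lemma cosh_ge1 (t : R) : 1 <= cosh t.
Proof.
have e0 := expR_gt0 t; have : expR t * expR (- t) = 1 by rewrite expRxMexpNx_1.
have := sqr_ge0 (expR t - 1); rewrite /cosh expRN; set e := expR t in e0 *.
move=> h _; rewrite ler_pdivlMr// -subr_ge0.
have -> : e + e^-1 - 1 * 2 = (e - 1) ^+ 2 / e by field; exact: lt0r_neq0.
by rewrite divr_ge0// ltW.
Qed.

Lemma expR_half_le_cosh (t : R) : expR t / 2 <= cosh t.
Proof. by rewrite /cosh ler_pM2r// lerDl expR_ge0. Qed.

Lemma cosh_le_expR_norm (t : R) : cosh t <= expR `|t|.
Proof.
have h1 : expR t <= expR `|t| by rewrite ler_expR ler_norm.
have h2 : expR (- t) <= expR `|t| by rewrite ler_expR -normrN ler_norm.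
by rewrite /cosh; lra.
Qed.

Lemma norm_sinh_le_cosh (t : R) : `|sinh t| <= cosh t.
Proof.
have h1 := expR_gt0 t; have h2 := expR_gt0 (- t).
by rewrite /sinh /cosh ler_norml; apply/andP; split; lra.
Qed.

End hyperbolic.

Section cosh_kernel.
Context {R : realType}.
Local Notation mu := (@lebesgue_measure R).
Local Notation halfline := (`[0, +oo[%classic : set R).

(** The weight [exp (- x cosh t)] decreases faster than any exponential, so it
    makes every function of this class integrable. *)
Definition exp_growth (f : R -> R) : Prop :=
  continuous f /\
  exists C m : R, 0 <= m /\ forall t, 0 <= t -> `|f t| <= C * expR (m * t).

Lemma exp_growth_cosh (a : R) : exp_growth (fun t => cosh (a * t)).
Proof.
split.
  move=> t; have H : is_derive t 1 (fun t : R => a * t) a.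
    by apply: is_derive_eq; rewrite /GRing.scale /= mulr1.
  exact: is_derive_continuous (is_derive1_comp (is_derive_cosh (a * t)) H).
exists 1, `|a|; split => // t t0; rewrite mul1r ger0_norm.
  by apply: (le_trans (cosh_le_expR_norm _)); rewrite normrM (ger0_norm t0).
exact: le_trans ler01 (cosh_ge1 _).
Qed.

Lemma exp_growth_sinh (a : R) : exp_growth (fun t => sinh (a * t)).
Proof.
split.
  move=> t; have H : is_derive t 1 (fun t : R => a * t) a.
    by apply: is_derive_eq; rewrite /GRing.scale /= mulr1.
  exact: is_derive_continuous (is_derive1_comp (is_derive_sinh (a * t)) H).
exists 1, `|a|; split => // t t0; rewrite mul1r.
apply: (le_trans (norm_sinh_le_cosh _)); apply: (le_trans (cosh_le_expR_norm _)).
by rewrite normrM (ger0_norm t0).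
Qed.

Lemma exp_growthM (f g : R -> R) : exp_growth f -> exp_growth g ->
  exp_growth (fun t => f t * g t).
Proof.
move=> [cf [C [m [m0 fC]]]] [cg [D [n [n0 gD]]]]; split.
  by move=> t; apply: continuousM; [exact: cf|exact: cg].
exists (C * D), (m + n); split; first exact: addr_ge0.
move=> t t0; rewrite normrM mulrDl expRD mulrACA.
by apply: ler_pM => //; [exact: fC|exact: gD].
Qed.

Lemma exp_growth_cosh_id : exp_growth (@cosh R).
Proof.
by have := exp_growth_cosh 1; under eq_fun do rewrite mul1r.
Qed.

Lemma exp_growth_sinh_id : exp_growth (@sinh R).
Proof.
by have := exp_growth_sinh 1; under eq_fun do rewrite mul1r.
Qed.

Definition cosh_integrand (f : R -> R) (x t : R) : R := expR (- (x * cosh t)) * f t.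

Definition cosh_transform (f : R -> R) (x : R) : R :=
  Rintegral mu halfline (cosh_integrand f x).

Let is_derive_kernel (x t : R) :
  is_derive t 1 (fun t => expR (- (x * cosh t)))
    (- (x * sinh t) * expR (- (x * cosh t))).
Proof.
have Hc := is_derive_cosh t.
by apply: is_derive_eq; rewrite /GRing.scale /=; ring.
Qed.

Lemma cosh_integrand_continuous (f : R -> R) (x : R) : exp_growth f ->
  {within halfline, continuous (cosh_integrand f x)}.
Proof.
move=> [cf _]; apply: continuous_subspaceT => t.
apply: (@cvgM _ _ (nbhs t)); last exact: cf.
exact: is_derive_continuous (is_derive_kernel x t).
Qed.

(** The bound is uniform for [x0 <= x], which makes the same function dominate
    the derivative with respect to [x]. Since [cosh t >= exp t / 2], it
    suffices to compare [(exp t)^(m + 1)] with [exp ((x0 / 2) * exp t)]. *)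
Lemma cosh_integrand_bound (f : R -> R) (x0 : R) : 0 < x0 -> exp_growth f ->
  exists M, forall x t : R, x0 <= x -> 0 <= t ->
    `|cosh_integrand f x t| <= M * expR (- (1 * t)).
Proof.
move=> x00 [_ [C [m [m0 fC]]]].
have m1 : 0 < m + 1 by lra.
have x2 : 0 < x0 / 2 by lra.
exists (C * ((m + 1) / (x0 / 2)) `^ (m + 1)) => x t xx t0.
rewrite /cosh_integrand normrM (ger0_norm (expR_ge0 _)).
have C0 : 0 <= C.
  by have := le_trans (normr_ge0 _) (fC 0 (lexx _)); rewrite mulr0 expR0 mulr1.
have h := powR_le_expR m1 x2 (expR_ge0 t).
rewrite -expRM in h.
set A := _ `^ _ in h *.
have A0 : 0 <= A by exact: powR_ge0.
have hx : x0 / 2 * expR t <= x * cosh t.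
  have := expR_half_le_cosh t; have := expR_gt0 t; nra.
have hx' : expR (x0 / 2 * expR t) <= expR (x * cosh t) by rewrite ler_expR.
have hh : expR (t * (m + 1)) <= A * expR (x * cosh t).
  by apply: (le_trans h); rewrite ler_wpM2l.
have -> : C * A * expR (- (1 * t)) =
    expR (- (x * cosh t)) * (C * (A * expR (x * cosh t) * expR (- t))).
  by rewrite mul1r -[LHS]mulr1 -(expRxMexpNx_1 (x * cosh t)); ring.
rewrite ler_pM2l ?expR_gt0//; apply: (le_trans (fC _ t0)).
rewrite ler_wpM2l//.
have -> : m * t = t * (m + 1) + - t by ring.
by rewrite expRD ler_wpM2r ?expR_ge0.
Qed.

Lemma integrable_cosh_integrand (f : R -> R) (x : R) : 0 < x -> exp_growth f ->
  mu.-integrable halfline (EFin \o cosh_integrand f x).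
Proof.
move=> x0 gf; have [M hM] := cosh_integrand_bound x0 gf.
apply: (@integrable_exp_dominated _ _ M 1) => //.
  exact: cosh_integrand_continuous.
by move=> t t0; exact: hM.
Qed.

Lemma cosh_transformD (f g : R -> R) (x : R) : 0 < x ->
  exp_growth f -> exp_growth g ->
  cosh_transform (fun t => f t + g t) x = cosh_transform f x + cosh_transform g x.
Proof.
move=> x0 gf gg; rewrite /cosh_transform -RintegralD//.
- by apply: eq_Rintegral => t _; rewrite /cosh_integrand mulrDr.
- exact: integrable_cosh_integrand.
- exact: integrable_cosh_integrand.
Qed.

Lemma cosh_transformB (f g : R -> R) (x : R) : 0 < x ->
  exp_growth f -> exp_growth g ->
  cosh_transform (fun t => f t - g t) x = cosh_transform f x - cosh_transform g x.
Proof.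
move=> x0 gf gg; rewrite /cosh_transform -RintegralB//.
- by apply: eq_Rintegral => t _; rewrite /cosh_integrand mulrBr.
- exact: integrable_cosh_integrand.
- exact: integrable_cosh_integrand.
Qed.

Lemma cosh_transform_le (f g : R -> R) (x : R) : 0 < x ->
  exp_growth f -> exp_growth g -> (forall t, f t <= g t) ->
  cosh_transform f x <= cosh_transform g x.
Proof.
move=> x0 gf gg fg; apply: le_Rintegral => //.
- exact: integrable_cosh_integrand.
- exact: integrable_cosh_integrand.
- by move=> t _; rewrite ler_wpM2l ?expR_ge0.
Qed.

Lemma is_derive_cosh_transform (f : R -> R) (x : R) : 0 < x -> exp_growth f ->
  is_derive x 1 (cosh_transform f)
    (- cosh_transform (fun t => cosh t * f t) x).
Proof.
move=> x0 gf; have gcf := exp_growthM exp_growth_cosh_id gf.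
have x2 : 0 < x / 2 by lra.
have [M hM] := cosh_integrand_bound x2 gcf.
have M0 : 0 <= M.
  have := le_trans (normr_ge0 _) (hM (x / 2) 0 (lexx _) (lexx _)).
  by rewrite mulr0 oppr0 expR0 mulr1.
have Dx (z t : R) : is_derive z 1 (fun z => cosh_integrand f z t)
    (- cosh_integrand (fun t => cosh t * f t) z t).
  by apply: is_derive_eq; rewrite /cosh_integrand /GRing.scale /=; ring.
have d1E z t : partial1of2 (cosh_integrand f) z t =
    - cosh_integrand (fun t => cosh t * f t) z t.
  by rewrite partial1of2E; case: (Dx z t).
have xI : `](x / 2), (x + 1)[%classic x by rewrite /= in_itv/=; apply/andP; split; lra.
have intf z : `](x / 2), (x + 1)[%classic z ->
    mu.-integrable halfline (EFin \o cosh_integrand f z).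
  rewrite /= in_itv/= => /andP[xz _]; apply: integrable_cosh_integrand => //.
  exact: lt_trans xz.
have derf z t : `](x / 2), (x + 1)[%classic z -> halfline t ->
    derivable ((cosh_integrand f)^~ t) z 1.
  by move=> _ _; case: (Dx z t).
have G0 t : 0 <= M * expR (- (1 * t)) by rewrite mulr_ge0 ?expR_ge0.
have intG : mu.-integrable halfline (EFin \o (fun t => M * expR (- (1 * t)))).
  exact: (@integrableZl _ _ _ mu halfline (measurable_itv _) M _
           (integrable_expRN ltr01)).
have ub z t : `](x / 2), (x + 1)[%classic z -> halfline t ->
    `|partial1of2 (cosh_integrand f) z t| <= M * expR (- (1 * t)).
  rewrite d1E normrN /= !in_itv/= andbT => /andP[xz _] t0.
  by apply: hM => //; exact: ltW.
apply: DeriveDef.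
  exact: (@derivable_under_integral R _ _ mu (cosh_integrand f) halfline
    (measurable_itv _) x _ _ xI intf derf _ G0 intG ub).
rewrite -derive1E.
rewrite (@differentiation_under_integral R _ _ mu (cosh_integrand f) halfline
  (measurable_itv _) x _ _ xI intf derf _ G0 intG ub).
rewrite -mulN1r /cosh_transform -RintegralZl//; last exact: integrable_cosh_integrand.
by apply: eq_Rintegral => t _; rewrite d1E mulN1r.
Qed.

(** The function [exp (- x cosh t) * sinh (nu t)] vanishes at both ends, so the
    integral of its derivative is 0. *)
Lemma cosh_transform_by_parts (nu x : R) : 0 < x ->
  nu * cosh_transform (fun t => cosh (nu * t)) x =
  x * cosh_transform (fun t => sinh t * sinh (nu * t)) x.
Proof.
move=> x0; have gc := exp_growth_cosh nu; have gs := exp_growth_sinh nu.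
have gss := exp_growthM exp_growth_sinh_id gs.
have [M0 hM0] := cosh_integrand_bound x0 gc.
have [M1 hM1] := cosh_integrand_bound x0 gss.
have [M hM] := cosh_integrand_bound x0 gs.
have ic := integrable_cosh_integrand x0 gc.
have iss := integrable_cosh_integrand x0 gss.
pose A (t : R) := cosh_integrand (fun t => cosh (nu * t)) x t.
pose B (t : R) := cosh_integrand (fun t => sinh t * sinh (nu * t)) x t.
have cA : {within halfline, continuous A} by exact: cosh_integrand_continuous.
have cB : {within halfline, continuous B} by exact: cosh_integrand_continuous.
pose F (t : R) := cosh_integrand (fun t => sinh (nu * t)) x t.
have DF (t : R) : is_derive t 1 F (nu * A t - x * B t).
  have Hk := is_derive_kernel x t.
  have Hnu : is_derive t 1 (fun t : R => nu * t) nu.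
    by apply: is_derive_eq; rewrite /GRing.scale /= mulr1.
  have Hs := is_derive1_comp (is_derive_sinh (nu * t)) Hnu.
  apply: (is_derive_eq (is_deriveM Hk Hs)).
  by rewrite /A /B /cosh_integrand /GRing.scale /=; ring.
have F00 : F 0 = 0 by rewrite /F /cosh_integrand mulr0 /sinh oppr0 subrr mul0r mulr0.
have : Rintegral mu halfline (fun t => nu * A t - x * B t) = - F 0.
  apply: (@Rintegral_halfline_FTC _ _ _ (`|nu| * M0 + x * M1) 1) => //.
  - move=> t; apply: cvgB; apply: cvgM; try exact: cvg_cst; [exact: cA|exact: cB].
  - move=> t t0; apply: (le_trans (ler_normB _ _)).
    rewrite [`|nu * A t|]normrM [`|x * B t|]normrM (ger0_norm (ltW x0)).
    rewrite mulrDl -!(mulrA _ _ (expR _)).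
    apply: lerD; rewrite ler_wpM2l ?(ltW x0)//.
      exact: (hM0 x t (lexx x) t0).
    exact: (hM1 x t (lexx x) t0).
  - apply/norm_cvg0P.
    apply: (@squeeze_cvgr _ _ _ _ (cst 0) (fun t => M * expR (- (1 * t)))).
    + near=> t.
      have t0 : 0 <= t by near: t; exact: nbhs_pinfty_ge.
      by rewrite normr_ge0 /=; exact: (hM x t (lexx x) t0).
    + exact: cvg_cst.
    + by rewrite -(mulr0 M); apply: cvgM; [exact: cvg_cst|exact: cvg_expRN_pinfty].
  - by apply: cvg_at_right_filter; exact: is_derive_continuous (DF 0).
rewrite F00 oppr0 RintegralB//; last 2 first.
- exact: (@integrableZl _ _ _ mu halfline (measurable_itv _) nu _ ic).
- exact: (@integrableZl _ _ _ mu halfline (measurable_itv _) x _ iss).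
by rewrite !RintegralZl// => /eqP; rewrite subr_eq0 => /eqP.
Unshelve. all: by end_near. Qed.

End cosh_kernel.

Section phi_plus.
Context {R : realType}.

Lemma besselKE (nu x : R) :
  besselK nu x = cosh_transform (fun t => cosh (nu * t)) x.
Proof. by []. Qed.

Lemma besselK_gt0 (nu x : R) : 0 < x -> 0 < besselK nu x.
Proof.
move=> x0; have gc := @exp_growth_cosh R nu.
have h t : 0 < cosh_integrand (fun t => cosh (nu * t)) x t.
  by rewrite mulr_gt0 ?expR_gt0//; exact: lt_le_trans ltr01 (cosh_ge1 _).
rewrite besselKE; apply: Rintegral_halfline_gt0 => //.
- exact: cosh_integrand_continuous.
- exact: integrable_cosh_integrand.
- by move=> t _; exact: ltW.
Qed.

Lemma besselK_by_parts (nu x : R) : 0 < x ->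
  nu / x * besselK nu x = cosh_transform (fun t => sinh t * sinh (nu * t)) x.
Proof.
move=> x0; rewrite mulrAC besselKE cosh_transform_by_parts// mulrAC.
by rewrite divff ?lt0r_neq0// mul1r.
Qed.

(** The addition formulas split the integrals for [nu + 1] and [nu - 1] into the
    same part in [cosh t * cosh (nu * t)], which is minus the derivative of
    [besselK nu], and opposite parts in [sinh t * sinh (nu * t)], which
    [besselK_by_parts] evaluates. The recurrence and the two differentiation
    formulas are combinations of these two decompositions. *)
Lemma besselK_addr1 (nu x : R) : 0 < x ->
  besselK (nu + 1) x =
  cosh_transform (fun t => cosh t * cosh (nu * t)) x + nu / x * besselK nu x.
Proof.
move=> x0; have gc := @exp_growth_cosh R nu; have gs := @exp_growth_sinh R nu.
rewrite besselK_by_parts// -cosh_transformD//; last 2 first.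
- exact: exp_growthM exp_growth_cosh_id gc.
- exact: exp_growthM exp_growth_sinh_id gs.
rewrite besselKE; congr cosh_transform; apply/funext => t.
by rewrite mulrDl mul1r coshD; ring.
Qed.

Lemma besselK_subr1 (nu x : R) : 0 < x ->
  besselK (nu - 1) x =
  cosh_transform (fun t => cosh t * cosh (nu * t)) x - nu / x * besselK nu x.
Proof.
move=> x0; have gc := @exp_growth_cosh R nu; have gs := @exp_growth_sinh R nu.
rewrite besselK_by_parts// -cosh_transformB//; last 2 first.
- exact: exp_growthM exp_growth_cosh_id gc.
- exact: exp_growthM exp_growth_sinh_id gs.
rewrite besselKE; congr cosh_transform; apply/funext => t.
by rewrite mulrBl mul1r coshB; ring.
Qed.

Lemma is_derive_besselK (nu x : R) : 0 < x ->
  is_derive x 1 (besselK nu) (- besselK (nu + 1) x + nu / x * besselK nu x).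
Proof.
move=> x0; rewrite besselK_addr1// opprD subrK.
exact: is_derive_cosh_transform (exp_growth_cosh nu).
Qed.

Lemma is_derive_besselK_addr1 (nu x : R) : 0 < x ->
  is_derive x 1 (besselK (nu + 1))
    (- besselK nu x - (nu + 1) / x * besselK (nu + 1) x).
Proof.
move=> x0; have := besselK_subr1 (nu + 1) x0; rewrite addrK => ->.
rewrite opprB addrAC subrr add0r.
exact: is_derive_cosh_transform (exp_growth_cosh (nu + 1)).
Qed.

Lemma besselK_le_cosh_moment (nu x : R) : 0 < x ->
  besselK nu x <= cosh_transform (fun t => cosh t * cosh (nu * t)) x.
Proof.
move=> x0; have gc := @exp_growth_cosh R nu; apply: cosh_transform_le => //.
  exact: exp_growthM exp_growth_cosh_id gc.
move=> t; rewrite ler_peMl ?cosh_ge1//.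
exact: le_trans ler01 (cosh_ge1 _).
Qed.

(** [besselK_le_cosh_moment] says that the logarithmic derivative of
    [besselK nu] is at most -1. *)
Lemma phi_plus_ge (nu x : R) : 0 < x -> nu + x <= phi_plus nu x.
Proof.
move=> x0; have K0 := besselK_gt0 nu x0.
rewrite /phi_plus /ratioK mulrA ler_pdivlMr// besselK_addr1//.
have := besselK_le_cosh_moment nu x0.
move: (cosh_transform _ _) (besselK _ _) K0 => A K K0 KA.
have -> : x * (A + nu / x * K) = x * A + nu * K by field; exact: lt0r_neq0.
nra.
Qed.

(** The same inequality for the order [nu + 1], where the logarithmic derivative
    is expressed through [besselK nu], bounds the ratio from above. *)
Lemma phi_plus_le (nu x : R) : 0 <= nu -> 2 * (nu + 1) <= x ->
  phi_plus nu x <= x + 2 * (nu + 1).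
Proof.
move=> n0 xn; have x0 : 0 < x by lra.
have K0 := besselK_gt0 nu x0; have K1 := besselK_gt0 (nu + 1) x0.
rewrite /phi_plus /ratioK mulrA ler_pdivrMr//.
have := besselK_le_cosh_moment (nu + 1) x0.
have := besselK_subr1 (nu + 1) x0; rewrite addrK.
move: (cosh_transform _ _) (besselK (nu + 1) _) (besselK _ _) K0 K1 =>
  A L K K0 L0 E LA.
have hL : x * L <= x * K + (nu + 1) * L.
  have -> : x * K + (nu + 1) * L = x * A by rewrite E; field; exact: lt0r_neq0.
  by rewrite ler_pM2l.
have a0 : 0 < x - (nu + 1) by lra.
have h1 : (x - (nu + 1)) * (x * L) <= x * (x * K) by nra.
have h2 : x * x <= (x - (nu + 1)) * (x + 2 * (nu + 1)) by nra.
rewrite -(ler_pM2l a0); apply: (le_trans h1); rewrite !mulrA ler_pM2r//.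
Qed.

Lemma phi_plus_gt0 (nu x : R) : 0 < x -> 0 < phi_plus nu x.
Proof. by move=> x0; rewrite mulr_gt0// divr_gt0// besselK_gt0. Qed.

Lemma phi_plus_rec (nu x : R) : 0 < x ->
  phi_plus (nu + 1) x = 2 * (nu + 1) + x ^+ 2 / phi_plus nu x.
Proof.
move=> x0; have K0 := besselK_gt0 nu x0; have K1 := besselK_gt0 (nu + 1) x0.
rewrite /phi_plus /ratioK.
rewrite (besselK_addr1 (nu + 1) x0).
have /eqP := besselK_subr1 (nu + 1) x0; rewrite addrK eq_sym subr_eq => /eqP ->.
move: (besselK (nu + 1) x) (besselK nu x) K0 K1 => L K K0 L0.
by field; rewrite !lt0r_neq0.
Qed.

Lemma is_derive_phi_plus (nu x : R) : 0 < x ->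
  is_derive x 1 (phi_plus nu)
    ((phi_plus nu x ^+ 2 - 2 * nu * phi_plus nu x - x ^+ 2) / x).
Proof.
move=> x0; have K0 := besselK_gt0 nu x0.
have HA := is_derive_besselK_addr1 nu x0.
have HV := is_deriveV (lt0r_neq0 K0) (is_derive_besselK nu x0).
apply: (is_derive_eq (is_deriveM (is_derive_id x (1 : R)) (is_deriveM HA HV))).
rewrite /phi_plus /ratioK /GRing.scale /= fctE.
move: (besselK (nu + 1) x) (besselK nu x) K0 => L K K0.
by field; rewrite !lt0r_neq0.
Qed.

End phi_plus.

(** * Slopes, bounds and accuracies *)

Section phi_minus_bounds.
Context {R : realType}.
Implicit Types nu x : R.

Lemma phi_minus_ge nu x : 1 / 2 <= nu -> 0 < x -> 2 * nu <= phi_minus nu x.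
Proof.
move=> nu_ge x0; have nu1 : 1 / 2 <= nu + 1 by lra.
rewrite phi_minus_rec// lerDl divr_ge0 ?sqr_ge0//.
exact: ltW (phi_minus_gt0 nu1 x0).
Qed.

Definition slope_minus nu x : R :=
  (x ^+ 2 + 2 * nu * phi_minus nu x - phi_minus nu x ^+ 2) / x.

Lemma slope_minus_bounds nu x : 1 / 2 <= nu -> 0 < x -> 0 < slope_minus nu x < 1.
Proof.
move=> nu_ge; have nu1 : 1 / 2 <= nu + 1 by lra.
have nu10 : 0 < 2 * (nu + 1) by lra.
apply: (decaying_riccati_slope nu_ge).
- by move=> z; exact: is_derive_phi_minus.
- by move=> z; exact: phi_minus_ge.
- move=> z z0; rewrite phi_minus_rec// lerD2l ler_wpM2l ?sqr_ge0//.
  by rewrite lef_pV2 ?posrE ?(phi_minus_gt0 nu1 z0)//; exact: phi_minus_ge.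
Qed.

Lemma phi_minus_root nu x : 1 / 2 <= nu -> 0 < x ->
  phi_minus nu x = slope_root nu x (- slope_minus nu x).
Proof.
move=> nu_ge x0; have := phi_minus_ge nu_ge x0.
rewrite /slope_minus; move: (phi_minus nu x) => P P_ge.
by apply: slope_rootE; [lra|field; exact: lt0r_neq0].
Qed.

Lemma phi_minus_bounds nu x : 1 / 2 <= nu -> 0 < x ->
  lower_bound nu x < phi_minus nu x < upper_bound nu x.
Proof.
move=> nu_ge x0; have /andP[s0 s1] := slope_minus_bounds nu_ge x0.
rewrite lower_bound_root upper_bound_root phi_minus_root//.
move: (slope_minus nu x) s0 s1 => s s0 s1.
by apply/andP; split; apply: slope_root_lt => //; lra.
Qed.

End phi_minus_bounds.

Section phi_plus_bounds.
Context {R : realType}.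
Implicit Types nu x : R.

Definition slope_plus nu x : R :=
  (phi_plus nu x ^+ 2 - 2 * nu * phi_plus nu x - x ^+ 2) / x.

Lemma slope_plus_bounds nu x : 1 / 2 <= nu -> 0 < x ->
  0 < slope_plus nu x <= 1 /\ (slope_plus nu x = 1 <-> nu = 1 / 2).
Proof.
move=> nu_ge; have nu0 : 0 <= nu by lra.
apply: (@growing_riccati_slope _ nu (phi_plus nu) (2 * (nu + 1)) (2 * (nu + 1))).
- exact: nu_ge.
- by move=> z; exact: is_derive_phi_plus.
- by move=> z; exact: phi_plus_ge.
- by move=> z; exact: phi_plus_le.
Qed.

Lemma phi_plus_root nu x : 0 < x ->
  phi_plus nu x = slope_root nu x (slope_plus nu x).
Proof.
move=> x0; have := phi_plus_ge nu x0.
rewrite /slope_plus; move: (phi_plus nu x) => P P_ge.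
by apply: slope_rootE; [lra|field; exact: lt0r_neq0].
Qed.

Lemma phi_plus_bounds nu x : 1 / 2 <= nu -> 0 < x ->
  lower_bound nu x < phi_plus nu x <= upper_bound nu x /\
  (phi_plus nu x = upper_bound nu x <-> nu = 1 / 2).
Proof.
move=> nu_ge x0; have [/andP[s0 s1] sE] := slope_plus_bounds nu_ge x0.
rewrite lower_bound_root upper_bound_root phi_plus_root//.
move: (slope_plus nu x) s0 s1 sE => s s0 s1 sE.
have lt_root (a b : R) : -1 <= a -> a < b -> slope_root nu x a < slope_root nu x b.
  exact: slope_root_lt.
have s_gtN1 : -1 < s by lra.
rewrite lt_root//=; split.
  by move: s1; rewrite le_eqVlt => /predU1P[->|/(lt_root _ _ (ltW s_gtN1))/ltW].
rewrite -sE; split => [|-> //] h.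
by apply/eqP; rewrite eq_le s1 leNgt; apply/negP => /(lt_root _ _ (ltW s_gtN1));
  rewrite h ltxx.
Qed.

End phi_plus_bounds.

Section accuracies.
Context {R : realType}.
Variable nu : R.
Hypothesis nu_ge : 1 / 2 <= nu.

Let nu1_ge : 1 / 2 <= nu + 1.
Proof. by have := nu_ge; lra. Qed.

Lemma cvg_phi_minus_0 : phi_minus nu x @[x --> 0^'+] --> 2 * nu.
Proof.
apply: (@squeeze_cvgr _ _ _ _ (lower_bound nu) (upper_bound nu)).
- near=> x.
  have x0 : 0 < x by near: x; exact: nbhs_right_gt.
  by have /andP[/ltW -> /ltW ->] := phi_minus_bounds nu_ge x0.
- exact: cvg_slope_root_0.
- exact: cvg_slope_root_0.
Unshelve. all: by end_near. Qed.

Lemma cvg_phi_plus_0 : phi_plus nu x @[x --> 0^'+] --> 2 * nu.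
Proof.
apply: (@squeeze_cvgr _ _ _ _ (lower_bound nu) (upper_bound nu)).
- near=> x.
  have x0 : 0 < x by near: x; exact: nbhs_right_gt.
  by have [/andP[/ltW -> ->] _] := phi_plus_bounds nu_ge x0.
- exact: cvg_slope_root_0.
- exact: cvg_slope_root_0.
Unshelve. all: by end_near. Qed.

(* [x ^+ 2 / P] is at most [S - (nu + 1)] for [S] the square root, and
   [(S - (nu + 1)) * (S + (nu + 1)) = x * (x + 1)]. *)
Let recurrence_plus (x P : R) : 0 < x -> 0 < P ->
  2 * (nu + 1) + x ^+ 2 / P <= slope_root (nu + 1) x 1 ->
  x / (x + 1) * (slope_root (nu + 1) x 1 - (nu + 1) + 1 * (nu + 1))
    + (nu - 1 * nu) <= P.
Proof.
move=> x0 P0; rewrite /slope_root.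
have q0 : 0 <= (nu + 1) ^+ 2 + x * (x + 1).
  by apply: addr_ge0; [exact: sqr_ge0|apply: mulr_ge0; lra].
have := sqr_sqrtr q0; have := sqrtr_ge0 ((nu + 1) ^+ 2 + x * (x + 1)).
move: (Num.sqrt _) => S S0 SE ub.
have x1 : 0 < x + 1 by lra.
have h : x ^+ 2 <= (S - (nu + 1)) * P by rewrite -ler_pdivrMr//; lra.
have n0 : 0 < S + (nu + 1) by have := nu_ge; lra.
rewrite !mul1r subrr addr0 mulrAC ler_pdivrMr// -(ler_pM2l x0).
have : x ^+ 2 * (S + (nu + 1)) <= (S - (nu + 1)) * P * (S + (nu + 1)).
  by rewrite ler_pM2r.
have -> : (S - (nu + 1)) * P * (S + (nu + 1)) = P * (S ^+ 2 - (nu + 1) ^+ 2) by ring.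
rewrite SE; lra.
Qed.

Let recurrence_minus (x Q : R) : 1 < x -> slope_root (nu + 1) x (-1) <= Q ->
  2 * nu + x ^+ 2 / Q <=
  x / (x + -1) * (slope_root (nu + 1) x (-1) - (nu + 1) + -1 * (nu + 1))
    + (nu - -1 * nu).
Proof.
move=> x1; rewrite /slope_root.
have n0 := nu_ge.
have q0 : 0 <= (nu + 1) ^+ 2 + x * (x + -1).
  by apply: addr_ge0; [exact: sqr_ge0|apply: mulr_ge0; lra].
have := sqr_sqrtr q0; have := sqrtr_ge0 ((nu + 1) ^+ 2 + x * (x + -1)).
move: (Num.sqrt _) => S S0 SE SQ.
have Q0 : 0 < Q by lra.
have xm : 0 < x + -1 by lra.
have x0 : 0 < x by lra.
have -> : 2 * nu = nu - -1 * nu by ring.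
have -> : nu + 1 + S - (nu + 1) + -1 * (nu + 1) = S - (nu + 1) by ring.
rewrite addrC lerD2r ler_pdivrMr//.
have TE : (nu + 1 + S) * (S - (nu + 1)) = x * (x + -1) by lra.
have T0 : 0 <= S - (nu + 1).
  by rewrite -(pmulr_rge0 _ (_ : 0 < nu + 1 + S)) ?TE; [exact: ltW (mulr_gt0 x0 xm)|lra].
have -> : x / (x + -1) * (S - (nu + 1)) * Q = x * ((S - (nu + 1)) * Q) / (x + -1).
  by field; exact: lt0r_neq0.
rewrite ler_pdivlMr// expr2 -mulrA ler_pM2l// -TE mulrC.
by rewrite ler_wpM2l.
Qed.

Lemma cvg_phi_plus_oo :
  x * (phi_plus nu x - x - (nu + 1 / 2)) @[x --> +oo] -->
    (nu ^+ 2 - 1 ^+ 2 / 4) / 2.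
Proof.
have := @cvg_slope_root_oo R nu 1.
have := @cvg_recurrence_bound R nu 1 (expr1n _ _).
apply: squeeze_cvgr; near=> x.
have x0 : 0 < x by near: x; exact: nbhs_pinfty_gt.
have [/andP[_ ub] _] := phi_plus_bounds nu1_ge x0.
have [/andP[_ ub0] _] := phi_plus_bounds nu_ge x0.
rewrite !ler_pM2l// !lerD2r; apply/andP; split; last exact: ub0.
apply: (recurrence_plus x0 (phi_plus_gt0 nu x0)).
by rewrite -(phi_plus_rec nu x0); exact: ub.
Unshelve. all: by end_near. Qed.

Lemma cvg_phi_minus_oo :
  x * (phi_minus nu x - x - (nu + -1 / 2)) @[x --> +oo] -->
    (nu ^+ 2 - (-1) ^+ 2 / 4) / 2.
Proof.
have s2 : (-1) ^+ 2 = 1 :> R by rewrite sqrrN expr1n.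
have := @cvg_recurrence_bound R nu (-1) s2.
have := @cvg_slope_root_oo R nu (-1).
apply: squeeze_cvgr; near=> x.
have x1 : 1 < x by near: x; exact: nbhs_pinfty_gt.
have x0 : 0 < x by exact: lt_trans x1.
have /andP[lb _] := phi_minus_bounds nu1_ge x0.
have /andP[lb0 _] := phi_minus_bounds nu_ge x0.
rewrite !ler_pM2l// !lerD2r; apply/andP; split; first exact: (ltW lb0).
rewrite (phi_minus_rec nu_ge x0).
exact: recurrence_minus x1 (ltW lb).
Unshelve. all: by end_near. Qed.

Let bound_divE (b : R -> R) (x : R) : 0 < x -> b x = x * (b x / x).
Proof. by move=> x0; rewrite mulrC divfK// lt0r_neq0. Qed.

Let nu2_neq0 : 2 * nu != 0.
Proof. by rewrite lt0r_neq0//; have := nu_ge; lra. Qed.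

Lemma accuracy_ratioK : accuracy 1 3 (ratioK nu) (fun x => upper_bound nu x / x).
Proof.
split.
  exists (fun=> 2 * nu), (fun=> -1), (fun=> 0%N).
  split; apply: first_terms_0_leading nu2_neq0 _ _.
  - by [].
  - exact: cvg_phi_plus_0.
  - by move=> x; exact: bound_divE.
  - exact: cvg_slope_root_0.
exists (nth 0 [:: 1; nu + 1 / 2; (nu ^+ 2 - 1 ^+ 2 / 4) / 2]); split.
  exact: (@first_terms_oo3 _ (phi_plus nu) _ _ _ _ cvg_phi_plus_oo).
apply: (@first_terms_oo3 _ (upper_bound nu)); first exact: bound_divE.
exact: cvg_slope_root_oo.
Qed.

Lemma accuracy_ratioI : accuracy 1 3 (ratioI nu) (fun x => lower_bound nu x / x).
Proof.
split.
  exists (fun=> 2 * nu), (fun=> -1), (fun=> 0%N).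
  split; apply: first_terms_0_leading nu2_neq0 _ _.
  - by [].
  - exact: cvg_phi_minus_0.
  - by move=> x; exact: bound_divE.
  - exact: cvg_slope_root_0.
exists (nth 0 [:: 1; nu + -1 / 2; (nu ^+ 2 - (-1) ^+ 2 / 4) / 2]); split.
  exact: (@first_terms_oo3 _ (phi_minus nu) _ _ _ _ cvg_phi_minus_oo).
apply: (@first_terms_oo3 _ (lower_bound nu)); first exact: bound_divE.
exact: cvg_slope_root_oo.
Qed.

End accuracies.

Unset Implicit Arguments.

Theorem theorem5 (R : realType) (nu : R) (hnu : 1 / 2 <= nu) :
  (forall x : R, 0 < x ->
     [/\ derivable (phi_minus nu) x 1,
         0 < derive1 (phi_minus nu) x <= 1
       & lower_bound nu x < phi_minus nu x <= upper_bound nu x]) /\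
  (forall x : R, 0 < x ->
     [/\ derivable (phi_plus nu) x 1,
         0 < derive1 (phi_plus nu) x <= 1
       & lower_bound nu x < phi_plus nu x <= upper_bound nu x]) /\
  (forall x : R, 0 < x ->
     [/\ derive1 (phi_minus nu) x <> 1,
         phi_minus nu x <> upper_bound nu x,
         derive1 (phi_plus nu) x = 1 <-> nu = 1 / 2
       & phi_plus nu x = upper_bound nu x <-> nu = 1 / 2]) /\
  accuracy 1 3 (ratioK nu) (fun x => upper_bound nu x / x) /\
  accuracy 1 3 (ratioI nu) (fun x => lower_bound nu x / x).
Proof.
have Dminus (x : R) : 0 < x ->
    derivable (phi_minus nu) x 1 /\ derive1 (phi_minus nu) x = slope_minus nu x.
  by move=> x0; rewrite derive1E; case: (is_derive_phi_minus hnu x0).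
have Dplus (x : R) : 0 < x ->
    derivable (phi_plus nu) x 1 /\ derive1 (phi_plus nu) x = slope_plus nu x.
  by move=> x0; rewrite derive1E; case: (is_derive_phi_plus nu x0).
split=> [x x0|].
  have [dx ->] := Dminus x x0.
  have /andP[s0 s1] := slope_minus_bounds hnu x0.
  have /andP[lb ub] := phi_minus_bounds hnu x0.
  by split; [exact: dx|rewrite s0 (ltW s1)|rewrite lb (ltW ub)].
split=> [x x0|].
  have [dx ->] := Dplus x x0.
  have [s01 _] := slope_plus_bounds hnu x0.
  have [bnd _] := phi_plus_bounds hnu x0.
  by split; [exact: dx|exact: s01|exact: bnd].
split=> [x x0|].
  have [_ ->] := Dminus x x0; have [_ ->] := Dplus x x0.
  have /andP[_ s1] := slope_minus_bounds hnu x0.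
  have /andP[_ ub] := phi_minus_bounds hnu x0.
  have [_ sE] := slope_plus_bounds hnu x0.
  have [_ bE] := phi_plus_bounds hnu x0.
  split; [| |exact: sE|exact: bE].
  - by apply/eqP; rewrite (lt_eqF s1).
  - by apply/eqP; rewrite (lt_eqF ub).
by split; [exact: accuracy_ratioK|exact: accuracy_ratioI].
Qed.
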